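(* Let $L$ be a countable metric signature and $\Omega$ a weak modulus. For every separable $L$-structure $A$, there exists an $\mathcal L_{\omega_1\omega}(L)$-sentence $\sigma_A$ (the Scott sentence of $A$) such that for every separable $L$-structure $B$, $$r_\infty(A,B)=0 \iff \sigma_A^B = 0,$$ and such that moreover the quantifier rank of $\sigma_A$ is equal to $\alpha_A+\omega$, where $\alpha_A$ is the ($\Omega$-)Scott rank of $A$. In particular, the class $\{B\in\mathcal M(L): r_\infty(A,B)=0\}$ is Borel in $\mathcal M(L)$ and its Borel complexity is bounded in terms of the Scott rank of $A$ (that is, for each $\alpha<\omega_1$ there is $\beta<\omega_1$ such that for every separable $L$-structure $A$ of Scott rank at most $\alpha$ this class is $\boldsymbol\Sigma^0_\beta$).
   Context: Moduli. For $n\in\mathbb N$ or $n=\mathbb N$, an $n$-ary modulus is a continuous function $\Delta:[0,\infty)^n\to[0,\infty)$ with $\Delta(0)=0$ and $\Delta(\delta)\le\Delta(\delta+\delta')\le\Delta(\delta)+\Delta(\delta')$. A weak modulus is a function $\Omega:[0,\infty)^{\mathbb N}\to[0,\infty]$ with $\Omega(0)=0$ and $\Omega(\delta)\le\Omega(\delta+\delta')\le\Omega(\delta)+\Omega(\delta')$ that is lower semicontinuous for the product topology and separately continuous in each argument; put $\Omega|_n(\delta_0,\dots,\delta_{n-1})=\Omega(\delta_0,\dots,\delta_{n-1},0,0,\dots)$. A map $f$ from a product of metric spaces $\prod_{i<n}X_i$ to a metric space respects $\Delta$ if $d(f(x),f(y))\le\Delta((d(x_i,y_i))_{i<n})$ for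 all $x,y$. Signatures and structures. A metric signature $L$ is a set of function and predicate symbols; each symbol $s$ has an arity $n_s$ and an $n_s$-ary modulus $\Delta_s$, and each predicate symbol $P$ also has a compact interval $I_P\subseteq\mathbb R$ (its bound). $L$ always contains a binary predicate symbol $d$ with $\Delta_d(\delta_1,\delta_2)=\delta_1+\delta_2$ and some bound. An $L$-structure $A$ is a complete metric space with maps $F^A:A^{n_F}\to A$ respecting $\Delta_F$ and functions $P^A:A^{n_P}\to I_P$ respecting $\Delta_P$, where $d$ is interpreted as the distance. Formulas. Variables are $x_0,x_1,\dots$. Terms and formulas carry moduli, formulas also carry bounds: $\Delta_{x_i}(\delta)=\delta_i$; $\Delta_{F(\bar\tau)}=\Delta_F\circ(\Delta_{\tau_i})_i$; an atomic formula $P(\bar\tau)$ has modulus $\Delta_P\circ(\Delta_{\tau_i})_i$ and bound $I_P$. If $f:\prod_i I_{\phi_i}\to\mathbb R$ is continuous, $f(\phi_0,\dots,\phi_{m-1})$ has modulus $\Delta_f\circ(\Delta_{\phi_i})_i$ and bound $f(\prod_i I_{\phi_i})$, where $\Delta_f(\delta)=\sup\{|f(x)-f(y)|:|x_i-y_i|\le\delta_i\}$; it is called a basic formula if all $\phi_i$ are atomic. $\mathcal L_{\omega_1\omega}(L)$-formulas are built from atomic formulas by such continuous connectives, by $\sup_{x_i}$ and $\inf_{x_i}$ (same bound; $\delta_i$ replaced by $0$ in the modulus), and by countable $\bigvee_i\phi_i,\bigwedge_i\phi_i$ (interpreted as $\sup_i,\inf_i$), allowed when all $\phi_i$ respect a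 common modulus and a common bound, which the result then respects. (A formula with modulus $\Delta$ and bound $I$ respects any $\Delta'\ge\Delta$, $I'\supseteq I$.) $\phi^A$ is the interpretation of $\phi$ in $A$; a sentence has no free variables. Quantifier rank: $0$ for atomic formulas; $\operatorname{qr}f(\phi_0,\dots,\phi_{m-1})=\max_i\operatorname{qr}\phi_i$; $\operatorname{qr}\bigvee_i\phi_i=\operatorname{qr}\bigwedge_i\phi_i=\sup_i\operatorname{qr}\phi_i$; $\operatorname{qr}\sup_x\phi=\operatorname{qr}\inf_x\phi=\operatorname{qr}\phi+1$. Back-and-forth pseudo-distances (with respect to $\Omega$), with values in $[0,\infty]$, for $L$-structures $A,B$, $\bar a\in A^n,\bar b\in B^n$: $r_0(A\bar a,B\bar b)=\sup_\phi|\phi^A(\bar a)-\phi^B(\bar b)|$ over all basic formulas $\phi(x_0,\dots,x_{n-1})$ respecting $\Omega|_n$; $r_\alpha=\sup_{\beta<\alpha}r_\beta$ for $\alpha$ limit or $\alpha=\infty$ (greater than all ordinals); $r_{\alpha+1}(A\bar a,B\bar b)=\sup_{c\in A,d\in B}\inf_{c'\in A,d'\in B}\max\bigl(r_\alpha(A\bar ac,B\bar bd'),r_\alpha(A\bar ac',B\bar bd)\bigr)$. For $n=0$ write $r_\alpha(A,B)$. The paper writes $A\mathrel{E_\infty}B$ for $r_\infty(A,B)=0$. The Scott rank $\alpha_A$ is the least ordinal $\alpha$ with $r_\alpha(A\bar a,A\bar b)=r_{\alpha+1}(A\bar a,A\bar b)$ for all $n$ and $\bar a,\bar b\in A^n$.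 The space $\mathcal M(L)$ ($L$ countable). Replace each $n$-ary function symbol $F$ by an $(n+1)$-ary predicate $D_F(\bar x,y)=d(F(\bar x),y)$ with modulus $\Delta_F(\delta)+\delta'$ and the bound of $d$, and enumerate the resulting predicates as $d=P_0,P_1,\dots$ with arities $n_0,n_1,\dots$. A sequence $(a_i)_{i\in\mathbb N}$ in $A$ is tail-dense if $\{a_i:i>k\}$ is dense in $A$ for every $k$. $\mathcal M(L)$ is the set of $p\in\prod_i\mathbb R^{\mathbb N^{n_i}}$ for which there are a separable $L$-structure $A$ and a tail-dense sequence $(a_i)$ in $A$ with $p(i)(j_0,\dots,j_{n_i-1})=P_i^A(a_{j_0},\dots,a_{j_{n_i-1}})$. With the product topology it is a Polish space. An element is identified with the corresponding structure with a distinguished tail-dense sequence indexed by $\mathbb N$. *)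

(* Defs.v *)
From HB Require Import structures.
From mathcomp Require Import all_boot all_order all_algebra.
From mathcomp Require Import all_classical all_reals all_analysis.

Set Implicit Arguments.
Unset Strict Implicit.
Unset Printing Implicit Defensive.

Import Order.TTheory GRing.Theory Num.Theory.
Import numFieldNormedType.Exports.
Local Open Scope classical_set_scope.
Local Open Scope ring_scope.

(** [osup f] is the least ordinal greater than every [f x].  An ordinal is
    represented by many trees, so equality of ordinals is [oeq]. *)
Inductive Ord : Type := osup (X : Type) (f : X -> Ord).

Fixpoint ole (a b : Ord) {struct a} : Prop :=
  match a, b with
  | osup X f, osup Y g => forall x, exists y, ole (f x) (g y)
  end.

Definition olt (a b : Ord) : Prop :=
  match b with osup Y g => exists y, ole a (g y) end.

Definition oeq (a b : Ord) : Prop := ole a b /\ ole b a.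

Definition ozero : Ord := osup (fun x : void => match x with end).
Definition osucc (a : Ord) : Ord := osup (fun _ : unit => a).
Definition omega : Ord := osup (fun n => iter n osucc ozero).

Definition oindex (a : Ord) : Type := match a with osup X f => X end.
Definition ochild (a : Ord) : oindex a -> Ord :=
  match a with osup X f => f end.

(** Supremum of a family (the least ordinal greater than or equal to all). *)
Definition olub (X : Type) (f : X -> Ord) : Ord :=
  osup (fun p : {x : X & oindex (f x)} => ochild (projT2 p)).

Definition omax (a b : Ord) : Ord :=
  olub (fun x : bool => if x then a else b).

(** [a + b] is the set of ordinals [c < a] and [a + c] with [c < b]. *)
Fixpoint oadd (a b : Ord) {struct b} : Ord :=
  match b with
  | osup X f => osup (fun s : oindex a + X =>
      match s with inl i => ochild i | inr x => oadd a (f x) end)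
  end.

Definition olimit (a : Ord) : Prop :=
  ~ oeq a ozero /\ forall b, ~ oeq a (osucc b).

(** [a < omega_1]. *)
Definition ocountable (a : Ord) : Prop :=
  exists f : nat -> Ord, forall b, olt b a -> exists n, oeq (f n) b.

Lemma ole_refl a : ole a a.
Proof. by elim: a => X f IH x; exists x; exact: IH. Qed.

Lemma ole_trans b a c : ole a b -> ole b c -> ole a c.
Proof.
elim: a b c => X f IH [Y g] [Z h] ab bc x.
have [y fg] := ab x; have [z gh] := bc y.
by exists z; apply: IH fg gh.
Qed.

Lemma oeq_refl a : oeq a a. Proof. by split; exact: ole_refl. Qed.

Lemma oeq_sym a b : oeq a b -> oeq b a. Proof. by case. Qed.

Lemma oeq_trans b a c : oeq a b -> oeq b c -> oeq a c.
Proof.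
by move=> [ab ba] [bc cb]; split; [exact: ole_trans ab bc|exact: ole_trans cb ba].
Qed.

Lemma olt_ole_trans b a c : olt a b -> ole b c -> olt a c.
Proof.
case: b c => [Y g] [Z h] [y ag] bc; have [z gh] := bc y.
by exists z; apply: ole_trans ag gh.
Qed.

Lemma olt_succ a : olt a (osucc a).
Proof. by exists tt; exact: ole_refl. Qed.

Lemma olt_oeq_succ a b : oeq a (osucc b) -> olt b a.
Proof. by move=> [_ ba]; apply: olt_ole_trans (olt_succ b) ba. Qed.

Lemma oeq_succ_inj a b : oeq (osucc a) (osucc b) -> oeq a b.
Proof. by move=> [/(_ tt)[_ ab] /(_ tt)[_ ba]]. Qed.

Lemma olt_wf : well_founded olt.
Proof.
suff h a : forall b, ole b a -> Acc olt b by move=> a; apply: (h a); exact: ole_refl.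
elim: a => X f IH [Y g] ba; constructor=> c [y cg].
by have [x gf] := ba y; apply: (IH x); apply: ole_trans cg gf.
Qed.

Section Moduli.
Context {R : realType}.

Definition orthant (I : Type) : set {ptws I -> R} :=
  [set delta | forall i, 0 <= delta i].

(** Only the values of [Delta] on the orthant matter. *)
Record is_modulus (I : Type) (Delta : (I -> R) -> R) : Prop := {
  modulus0 : Delta (fun=> 0) = 0 ;
  modulus_ge0 : forall delta, orthant delta -> 0 <= Delta delta ;
  modulus_le : forall delta delta', orthant delta -> orthant delta' ->
    Delta delta <= Delta (fun i => delta i + delta' i) ;
  modulus_sub : forall delta delta', orthant delta -> orthant delta' ->
    Delta (fun i => delta i + delta' i) <= Delta delta + Delta delta' ;
  modulus_cont :
    {within orthant (I := I), continuous (Delta : {ptws I -> R} -> R)} }.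

Record is_weak_modulus (Omega : (nat -> R) -> \bar R) : Prop := {
  weak_modulus0 : Omega (fun=> 0) = 0%E ;
  weak_modulus_ge0 : forall delta, orthant delta -> (0 <= Omega delta)%E ;
  weak_modulus_le : forall delta delta', orthant delta -> orthant delta' ->
    (Omega delta <= Omega (fun i => delta i + delta' i)%R)%E ;
  weak_modulus_sub : forall delta delta', orthant delta -> orthant delta' ->
    (Omega (fun i => delta i + delta' i)%R <= Omega delta + Omega delta')%E ;
  weak_modulus_lsc :
    lower_semicontinuous (Omega : subspace (orthant (I := nat)) -> \bar R) ;
  weak_modulus_sep : forall delta i, orthant delta ->
    {within `[0, +oo[, continuous (fun t => Omega [eta delta with i |-> t])} }.

(** [Omega|_n], extended to infinite sequences by ignoring all coordinates
    beyond the first [n]. *)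
Definition weak_modulus_restr (Omega : (nat -> R) -> \bar R) (n : nat)
    (delta : nat -> R) : \bar R :=
  Omega (fun i => if (i < n)%N then delta i else 0).

End Moduli.

(** The distance symbol is not among [psym]; it is added by [pred_symbol]. *)
Record signature (R : realType) := Signature {
  fsym : Type ;
  farity : fsym -> nat ;
  fmod : forall F, ('I_(farity F) -> R) -> R ;
  fmodP : forall F, is_modulus (@fmod F) ;
  psym : Type ;
  psym_arity : psym -> nat ;
  psym_mod : forall P, ('I_(psym_arity P) -> R) -> R ;
  psym_modP : forall P, is_modulus (@psym_mod P) ;
  psym_lo : psym -> R ;
  psym_hi : psym -> R ;
  psym_lohi : forall P, psym_lo P <= psym_hi P ;
  dist_lo : R ;
  dist_hi : R ;
  dist_lohi : dist_lo <= dist_hi }.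

#[short(type="completeMetricType")]
HB.structure Definition CompleteMetric (R : realType) :=
  {T of Complete T & Metric R T}.

Section Logic.
Context {R : realType}.
Variable L : signature R.

Definition countable_signature : Prop :=
  countable [set: fsym L] /\ countable [set: psym L].

Inductive pred_symbol : Type := Dist | Pred (P : psym L).

Definition parity (P : pred_symbol) : nat :=
  match P with Dist => 2 | Pred P => psym_arity P end.

Definition pmod (P : pred_symbol) : ('I_(parity P) -> R) -> R :=
  match P with
  | Dist => fun delta : 'I_2 -> R => delta ord0 + delta ord_max
  | Pred P => @psym_mod _ _ P
  end.

Definition pbound (P : pred_symbol) : set R :=
  match P with
  | Dist => `[dist_lo L, dist_hi L]
  | Pred P => `[psym_lo P, psym_hi P]
  end.

(** The library's complete spaces are pointed, hence nonempty. *)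
Record structure := Structure {
  carrier :> completeMetricType R ;
  dist_bound : forall x y : carrier, pbound Dist (mdist x y) ;
  fint : forall F : fsym L, ('I_(farity F) -> carrier) -> carrier ;
  fint_respects : forall F (x y : 'I_(farity F) -> carrier),
    mdist (fint x) (fint y) <= fmod (fun i => mdist (x i) (y i)) ;
  psym_int : forall P : psym L, ('I_(psym_arity P) -> carrier) -> R ;
  psym_int_bound : forall P (x : 'I_(psym_arity P) -> carrier),
    pbound (Pred P) (psym_int x) ;
  psym_int_respects : forall P (x y : 'I_(psym_arity P) -> carrier),
    `|psym_int x - psym_int y| <= psym_mod (fun i => mdist (x i) (y i)) }.

Definition pint (A : structure) (P : pred_symbol) :
    ('I_(parity P) -> A) -> R :=
  match P with
  | Dist => fun x : 'I_2 -> A => mdist (x ord0) (x ord_max)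
  | Pred P => @psym_int A P
  end.

Definition separable (A : structure) : Prop :=
  exists2 D : set A, countable D & dense D.

Inductive term : Type :=
| Var (i : nat)
| App (F : fsym L) (tau : 'I_(farity F) -> term).

(** A countable disjunction or conjunction carries the common modulus [Delta]
    and the endpoints [lo], [hi] of the common bound that license it; these are
    the modulus and the bound of the resulting formula.  Side conditions are
    in [well_formed]. *)
Inductive formula : Type :=
| Atom (P : pred_symbol) (tau : 'I_(parity P) -> term)
| Conn (m : nat) (f : ('I_m -> R) -> R) (phi : 'I_m -> formula)
| QSup (i : nat) (phi : formula)
| QInf (i : nat) (phi : formula)
| Vee (Delta : (nat -> R) -> R) (lo hi : R) (phi : nat -> formula)
| Wedge (Delta : (nat -> R) -> R) (lo hi : R) (phi : nat -> formula).

Fixpoint tmodulus (t : term) (delta : nat -> R) : R :=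
  match t with
  | Var i => delta i
  | App F tau => fmod (fun k => tmodulus (tau k) delta)
  end.

Fixpoint bound (phi : formula) : set R :=
  match phi with
  | Atom P _ => pbound P
  | Conn m f psi => f @` [set x | forall i, bound (psi i) (x i)]
  | QSup _ psi | QInf _ psi => bound psi
  | Vee _ lo hi _ | Wedge _ lo hi _ => `[lo, hi]
  end.

Definition box (m : nat) (psi : 'I_m -> formula) : set {ptws 'I_m -> R} :=
  [set x | forall i, bound (psi i) (x i)].

Definition conn_modulus (m : nat) (f : ('I_m -> R) -> R)
    (D : set {ptws 'I_m -> R}) (delta : 'I_m -> R) : R :=
  sup [set z | exists x y, [/\ D x, D y,
    forall i, `|x i - y i| <= delta i & z = `|f x - f y|] ].

Fixpoint modulus (phi : formula) (delta : nat -> R) : R :=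
  match phi with
  | Atom P tau => pmod (fun k => tmodulus (tau k) delta)
  | Conn m f psi => conn_modulus f (box psi) (fun i => modulus (psi i) delta)
  | QSup i psi | QInf i psi => modulus psi [eta delta with i |-> 0]
  | Vee Delta _ _ _ | Wedge Delta _ _ _ => Delta delta
  end.

Definition respects_common (Delta : (nat -> R) -> R) (lo hi : R)
    (phi : nat -> formula) : Prop :=
  [/\ is_modulus Delta, lo <= hi,
      forall k delta, orthant delta -> modulus (phi k) delta <= Delta delta
    & forall k, bound (phi k) `<=` `[lo, hi] ].

Fixpoint well_formed (phi : formula) : Prop :=
  match phi with
  | Atom _ _ => True
  | Conn m f psi => (forall i, well_formed (psi i)) /\
      {within box psi, continuous (f : {ptws 'I_m -> R} -> R)}
  | QSup _ psi | QInf _ psi => well_formed psi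
  | Vee Delta lo hi psi | Wedge Delta lo hi psi =>
      (forall k, well_formed (psi k)) /\ respects_common Delta lo hi psi
  end.

Fixpoint tfv (t : term) : set nat :=
  match t with
  | Var i => [set i]
  | App F tau => \bigcup_k tfv (tau k)
  end.

Fixpoint fv (phi : formula) : set nat :=
  match phi with
  | Atom P tau => \bigcup_k tfv (tau k)
  | Conn m f psi => \bigcup_i fv (psi i)
  | QSup i psi | QInf i psi => fv psi `\ i
  | Vee _ _ _ psi | Wedge _ _ _ psi => \bigcup_k fv (psi k)
  end.

Definition sentence (phi : formula) : Prop :=
  well_formed phi /\ fv phi = set0.

Fixpoint qr (phi : formula) : Ord :=
  match phi with
  | Atom _ _ => ozero
  | Conn m f psi => \big[omax/ozero]_(i < m) qr (psi i)
  | QSup _ psi | QInf _ psi => osucc (qr psi)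
  | Vee _ _ _ psi | Wedge _ _ _ psi => olub (fun k => qr (psi k))
  end.

Fixpoint teval (A : structure) (v : nat -> A) (t : term) : A :=
  match t with
  | Var i => v i
  | App F tau => fint (fun k => teval v (tau k))
  end.

Fixpoint eval (A : structure) (v : nat -> A) (phi : formula) : R :=
  match phi with
  | Atom P tau => pint (fun k => teval v (tau k))
  | Conn m f psi => f (fun i => eval v (psi i))
  | QSup i psi => sup [set eval [eta v with i |-> c] psi | c in [set: A]]
  | QInf i psi => inf [set eval [eta v with i |-> c] psi | c in [set: A]]
  | Vee _ _ _ psi => sup [set eval v (psi k) | k in [set: nat]]
  | Wedge _ _ _ psi => inf [set eval v (psi k) | k in [set: nat]]
  end.

(** [phi^A(a)] for a formula whose free variables are among the first [n]; the
    value given to the other variables is irrelevant. *)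
Definition interp (A : structure) (n : nat) (a : n.-tuple A)
    (phi : formula) : R :=
  eval (nth point a) phi.

Definition basic (phi : formula) : Prop :=
  exists (m : nat) (f : ('I_m -> R) -> R) (P : 'I_m -> pred_symbol)
    (tau : forall i, 'I_(parity (P i)) -> term),
    phi = Conn f (fun i => Atom (tau i)).

Section BackAndForth.
Variable Omega : (nat -> R) -> \bar R.
Local Open Scope ereal_scope.

Definition basic_formulas (n : nat) : set formula :=
  [set phi | [/\ basic phi, well_formed phi, fv phi `<=` [set i | (i < n)%N]
    & forall delta, orthant delta ->
        (modulus phi delta)%:E <= weak_modulus_restr Omega n delta] ].

Definition pdist (A B : structure) : Type :=
  forall n, n.-tuple A -> n.-tuple B -> \bar R.

Section TwoStructures.
Variables A B : structure.

Definition bf0 : pdist A B := fun n a b =>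
  ereal_sup [set `|interp a phi - interp b phi|%:E | phi in basic_formulas n].

Definition bf_step (r : pdist A B) : pdist A B := fun n a b =>
  ereal_sup [set
    ereal_inf [set
      maxe (r n.+1 (rcons_tuple a x.1) (rcons_tuple b y.2))
           (r n.+1 (rcons_tuple a y.1) (rcons_tuple b x.2))
    | y in [set: A * B] ]
  | x in [set: A * B] ].

Definition bf_body (alpha : Ord)
    (r : forall beta, olt beta alpha -> pdist A B) : pdist A B :=
  if pselect (oeq alpha ozero) is left _ then bf0
  else if pselect (exists beta, oeq alpha (osucc beta)) is left h then
    bf_step (r (projT1 (cid h)) (olt_oeq_succ (projT2 (cid h))))
  else fun n a b => ereal_sup [set z |
    exists (beta : Ord) (h : olt beta alpha), z = r beta h n a b].

(** See [bf_zero], [bf_succ] and [bf_limit] for the recursion equations. *)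
Definition bf (alpha : Ord) : pdist A B :=
  Fix olt_wf (fun _ => pdist A B) bf_body alpha.

Definition bf_infty : pdist A B := fun n a b =>
  ereal_sup [set bf alpha a b | alpha in [set: Ord] ].

Lemma bfE alpha : bf alpha = @bf_body alpha (fun beta _ => bf beta).
Proof.
rewrite /bf Fix_eq // => x f g fg; congr bf_body.
by apply/functional_extensionality_dep => y; apply/functional_extensionality_dep.
Qed.

Lemma bf_oeq alpha beta : oeq alpha beta -> bf alpha = bf beta.
Proof.
elim: (olt_wf alpha) beta => {}alpha _ IH beta ab.
rewrite [LHS]bfE [RHS]bfE /bf_body.
case: (pselect (oeq alpha ozero)) => a0.
  case: pselect => // -[]; exact: oeq_trans (oeq_sym ab) a0.
case: (pselect (oeq beta ozero)) => [b0|_].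
  by case: a0; exact: oeq_trans ab b0.
case: (pselect (exists _, oeq alpha _)) => [ha|ha].
  case: pselect => [hb|[]]; last first.
    by case: ha => c ac; exists c; exact: oeq_trans (oeq_sym ab) ac.
  case: cid => c ac; case: cid => d bd /=; congr bf_step.
  apply: IH (olt_oeq_succ ac) _ _; apply: oeq_succ_inj.
  exact: oeq_trans (oeq_sym ac) (oeq_trans ab bd).
case: pselect => [[c bc]|_].
  by case: ha; exists c; exact: oeq_trans ab bc.
apply/functional_extensionality_dep => n; apply/funext => x; apply/funext => y.
congr ereal_sup; apply/seteqP; split=> z [c [h ->]]; exists c.
- by exists (olt_ole_trans h ab.1).
- by exists (olt_ole_trans h ab.2).
Qed.

Lemma bf_zero : bf ozero = bf0.
Proof. by rewrite bfE /bf_body; case: pselect => // -[]; exact: oeq_refl. Qed.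

Lemma bf_succ alpha : bf (osucc alpha) = bf_step (bf alpha).
Proof.
rewrite bfE /bf_body; case: pselect => [[/(_ tt) [] []]//|_].
case: pselect => [h|[]]; last by exists alpha; exact: oeq_refl.
case: cid => b ab /=; congr bf_step.
exact/bf_oeq/oeq_succ_inj/oeq_sym.
Qed.

Lemma bf_limit alpha : olimit alpha -> forall n (a : n.-tuple A) (b : n.-tuple B),
  bf alpha a b = ereal_sup [set bf beta a b | beta in [set beta | olt beta alpha] ].
Proof.
move=> [a0 aS] n a b; rewrite bfE /bf_body; case: pselect => //= _.
case: pselect => [[c /aS]//|_]; congr ereal_sup.
apply/seteqP; split=> z; first by move=> [c [h ->]]; exists c.
by move=> [c h <-]; exists c; exists h.
Qed.

End TwoStructures.

Definition bf_stable (A : structure) (alpha : Ord) : Prop :=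
  forall n (a b : n.-tuple A), bf alpha a b = bf (osucc alpha) a b.

Definition is_scott_rank (A : structure) (alpha : Ord) : Prop :=
  bf_stable A alpha /\ forall beta, bf_stable A beta -> ole alpha beta.

End BackAndForth.

(** [Graph F] stands for the predicate d(F(x), y).  The factors of the product
    are indexed by the symbols themselves instead of an enumeration of them. *)
Inductive rel_symbol : Type := RPred (P : pred_symbol) | Graph (F : fsym L).

Definition rarity (s : rel_symbol) : nat :=
  match s with RPred P => parity P | Graph F => (farity F).+1 end.

Definition rint (A : structure) (s : rel_symbol) : ('I_(rarity s) -> A) -> R :=
  match s with
  | RPred P => @pint A P
  | Graph F => fun x : 'I_(farity F).+1 -> A =>
      mdist (fint (fun i : 'I_(farity F) => x (widen_ord (leqnSn _) i)))
            (x ord_max)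
  end.

Definition code_space : Type :=
  prod_topology (fun s : rel_symbol => {ptws ('I_(rarity s) -> nat) -> R}).

HB.instance Definition _ := Topological.copy code_space
  (prod_topology (fun s : rel_symbol => {ptws ('I_(rarity s) -> nat) -> R})).

Definition tail_dense (A : structure) (a : nat -> A) : Prop :=
  forall k, dense [set a i | i in [set i | (k < i)%N] ].

Definition code (A : structure) (a : nat -> A) : code_space :=
  fun s j => rint (fun k => a (j k)).

Definition codes (p : code_space) (A : structure) : Prop :=
  separable A /\ exists2 a : nat -> A, tail_dense a & p = code a.

Definition ML : set code_space := [set p | exists A, codes p A].

(** [codes] determines the structure up to isomorphism. *)
Definition Einfty_class (Omega : (nat -> R) -> \bar R) (A : structure) :
    set ML :=
  [set p | exists2 B, codes (set_val p) B &
    bf_infty Omega (nil_tuple A) (nil_tuple B) = 0%E].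

End Logic.

Arguments ML {R} L.
Arguments code_space {R} L.

Inductive Sigma0 (T : topologicalType) : Ord -> set T -> Prop :=
| Sigma0_open xi (U : set T) :
    oeq xi (osucc ozero) -> open U -> Sigma0 xi U
| Sigma0_bigcup xi (eta : nat -> Ord) (F : nat -> set T) :
    olt (osucc ozero) xi ->
    (forall n, ole (osucc ozero) (eta n)) -> (forall n, olt (eta n) xi) ->
    (forall n, Sigma0 (eta n) (~` F n)) ->
    Sigma0 xi (\bigcup_n F n).

(* Main.v *)
(** The distances [bf alpha] increase with [alpha], satisfy a triangle inequality
    across structures, and satisfy [bf alpha (A a) (A a') <= Omega (d a a')]; so
    they are determined by dense sequences, and every stage before stabilisation
    is witnessed by a pair of tuples from dense sequences and a rational.  Hence
    a separable pair stabilises at a countable ordinal, and Scott ranks are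
    countable.  By induction on a countable [alpha], the function
    [b |-> min 1 (bf alpha (A a) (B b))] is the value of a formula of rank
    [alpha]: stage 0 is a countable supremum by a hereditary Lindelof argument,
    and at successor stages the quantifier over [A] runs over a dense sequence.

    If [alpha] is the Scott rank of [A], then [A] and [B] are at distance 0 iff
    stage [alpha] vanishes on [(A, B)] and stage [alpha + 1] does not exceed stage
    [alpha] on any [(A a, B b)]; this condition is the Scott sentence.  Evaluated
    along a tail-dense sequence of [B], the stages become iterated countable
    suprema and infima of continuous functions of the code of [B], because the
    value of an atomic formula is continuous in the code; each stage raises the
    Borel class by a bounded amount. *)
Require Import Defs.
From mathcomp Require Import all_boot all_order all_algebra.
From mathcomp Require Import all_classical all_reals all_analysis.
From mathcomp Require Import lra.

Set Implicit Arguments.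
Unset Strict Implicit.
Unset Printing Implicit Defensive.

Import Order.TTheory GRing.Theory Num.Theory.
Import numFieldNormedType.Exports.
Local Open Scope classical_set_scope.
Local Open Scope ring_scope.

Local Notation eval := Defs.eval.
Local Notation fsym := Defs.fsym.
Local Notation oone := (osucc ozero).

(** * Ordinals *)

(** The Scott rank speaks only of pairs of tuples inside [A], whereas the sentence must speak of
    [B]. The bridge is the triangle inequality: once [A] and [B] are at distance 0, every tuple of
    [B] is approximated by tuples of [A] at any prescribed stage, and then stability of [alpha]
    passes from [A] to the pair. The approximation is built by playing one move per entry, and a
    move normally costs a stage; starting from a stage that is stable for the pair avoids this loss.

    A second obstacle is that distances and weak moduli may be infinite, while formulas have compact
    bounds and real moduli. Both are cut off at 1. The truncated distances obey the same recursion
    as the original ones and vanish exactly when those do, so the criterion can be stated and proved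
    for them alone.

    Finally the Borel bound must not depend on [A]; for this reason the level of each stage is fixed
    before the structure. *)

Lemma oleE X (f : X -> Ord) b : ole (osup f) b = (forall x, olt (f x) b).
Proof. by case: b. Qed.

Lemma olt_osup X (f : X -> Ord) x : olt (f x) (osup f).
Proof. by exists x; exact: ole_refl. Qed.

Lemma ole_olt_trans b a c : ole a b -> olt b c -> olt a c.
Proof. by case: c => Z h ab [z bz]; exists z; exact: ole_trans ab bz. Qed.

Lemma oltW a b : olt a b -> ole a b.
Proof.
elim: a b => X f IH [Y g] [y h] x; exists y; apply: IH.
by rewrite oleE in h.
Qed.

Lemma olt_irr a : ~ olt a a.
Proof.
elim/(well_founded_induction olt_wf): a => a IH h.
exact: (IH a h h).
Qed.

(** If some [f x] is bounded by no [g y], induction puts every [g y] strictly below [f x], which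
    therefore bounds [osup g]. *)
Lemma ole_or_olt a b : ole a b \/ olt b a.
Proof.
elim: a b => X f IH [Y g].
have [|/existsNP[x /forallNP h]] := pselect (ole (osup f) (osup g)); first by left.
by right; exists x; rewrite oleE => y; have [/h|] := IH x (g y).
Qed.

Lemma ole_succ a b : ole (osucc a) b <-> olt a b.
Proof. by rewrite oleE; split => [/(_ tt)|h []]. Qed.

Lemma olt_succE a b : olt a (osucc b) <-> ole a b.
Proof. by split=> [[]|h] //; exists tt. Qed.

Lemma ole_succ2 a b : ole (osucc a) (osucc b) <-> ole a b.
Proof. by rewrite ole_succ olt_succE. Qed.

Lemma oeq_succ a b : oeq a b -> oeq (osucc a) (osucc b).
Proof. by move=> [ab ba]; split; apply/ole_succ2. Qed.

Lemma ole_zero a : ole ozero a.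
Proof. by rewrite oleE => -[]. Qed.

Lemma olt_zero a : ~ olt a ozero.
Proof. by move=> []. Qed.

Lemma ole_olub X (f : X -> Ord) x : ole (f x) (olub f).
Proof.
case fx: (f x) => [Y g]; rewrite oleE => y; rewrite /olub.
have y' : oindex (f x) by rewrite fx; exact: y.
suff [z ->] : exists z : oindex (f x), g y = ochild z.
  exact: (@olt_osup {x : X & oindex (f x)} (fun p => ochild (projT2 p)) (existT _ x z)).
by rewrite fx; exists y.
Qed.

Lemma ole_ochild a b : ole a b <-> forall x : oindex a, olt (ochild x) b.
Proof. by case: a => X f; rewrite oleE. Qed.

Lemma olub_ole X (f : X -> Ord) b : (forall x, ole (f x) b) -> ole (olub f) b.
Proof. by move=> h; rewrite oleE => -[x y] /=; exact: (ole_ochild _ _).1 (h x) y. Qed.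

Lemma olubP X (f : X -> Ord) b : ole (olub f) b <-> forall x, ole (f x) b.
Proof.
split=> [h x|]; [exact: ole_trans (ole_olub f x) h|exact: olub_ole].
Qed.

Lemma omaxP a b c : ole (omax a b) c <-> ole a c /\ ole b c.
Proof.
rewrite olubP; split=> [h|[ha hb] []//].
by split; [exact: (h true)|exact: (h false)].
Qed.

Lemma bigomaxP m (f : 'I_m -> Ord) b :
  ole (\big[omax/ozero]_(i < m) f i) b <-> forall i, ole (f i) b.
Proof.
elim: m f => [|m IH] f.
  by rewrite big_ord0; split=> [_ []//|_]; exact: ole_zero.
rewrite big_ord_recl omaxP IH; split=> [[h0 h] i|h]; last by [].
by case: (unliftP ord0 i) => [j ->|->].
Qed.

Lemma olt_limit_succ a b : olimit a -> olt b a -> olt (osucc b) a.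
Proof.
move=> [_ la] ba; have /ole_succ h : olt b a by [].
have [ab|//] := ole_or_olt a (osucc b).
by case: (la b).
Qed.

Lemma ord_cases a : oeq a ozero \/ (exists b, oeq a (osucc b)) \/ olimit a.
Proof.
have [|a0] := pselect (oeq a ozero); first by left.
right; have [|/forallNP] := pselect (exists b, oeq a (osucc b)); first by left.
by right.
Qed.

Lemma ord_least (P : Ord -> Prop) : (exists a, P a) ->
  exists2 a, P a & forall b, P b -> ole a b.
Proof.
move=> [a]; elim/(well_founded_induction olt_wf): a => a IH Pa.
have [[b [Pb ba]]|/forallNP h] := pselect (exists b, P b /\ olt b a); first exact: IH ba Pb.
exists a => // b Pb; have [//|ba] := ole_or_olt a b.
by case: (h b).
Qed.

(** The sequence [f] is cofinal with the iterated successors of [a], whose supremum is [a + omega].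
    The rank of the Scott sentence is recognised in this way. *)
Lemma oeq_add_omega (a : Ord) (f : nat -> Ord) :
  (forall n, exists m, ole (f n) (iter m osucc a)) ->
  (forall n, exists m, ole (iter n osucc a) (f m)) ->
  oeq (olub f) (oadd a omega).
Proof.
move=> h1 h2.
have addE n : oeq (oadd a (iter n osucc ozero)) (iter n osucc a).
  elim: n => [|n IH] /=.
    split; apply/ole_ochild.
      by move=> [i|[]]; case: a {h1 h2} i => X g i; exact: olt_osup.
    by move=> i; exact: (@olt_osup (oindex a + void) _ (inl i)).
  split; apply/ole_ochild.
    move=> [i|[]].
      have /ole_ochild/(_ i) : ole a (iter n.+1 osucc a); last by [].
      elim: {IH}n.+1 => [|k IH]; first exact: ole_refl.
      exact: ole_trans IH (oltW (olt_succ _)).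
    exact/olt_succE/IH.1.
  by move=> []; apply: ole_olt_trans IH.2 _; exact: (@olt_osup (oindex a + unit) _ (inr tt)).
have lt n : olt (iter n osucc a) (oadd a omega).
  apply: ole_olt_trans (addE n).2 _.
  exact: (@olt_osup (oindex a + nat) _ (inr n)).
split.
  apply/olubP => n; have [m h] := h1 n.
  exact: ole_trans h (oltW (lt m)).
apply/ole_ochild => -[i|n].
  have [m h] := h2 0%N.
  exact: (ole_ochild _ _).1 (ole_trans h (ole_olub f m)) i.
apply: ole_olt_trans (addE n).1 _.
have [m h] := h2 n.+1.
exact: (ole_succ _ _).1 (ole_trans h (ole_olub f m)).
Qed.

Lemma ocountable_ole a b : ole a b -> ocountable b -> ocountable a.
Proof. by move=> ab [f h]; exists f => c ca; apply: h; exact: olt_ole_trans ca ab. Qed.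

Lemma ocountable_osup (g : nat -> Ord) :
  (forall n, ocountable (g n)) -> ocountable (osup g).
Proof.
move=> /choice[f hf].
(* The pair [(n, Some m)] gives the [m]-th entry of the enumeration for [g n], and [(n, None)] gives
   [g n] itself. *)
exists (fun k => if unpickle k is Some (n, o) then
  (if o is Some m then f n m else g n) else ozero).
move=> b [n bn].
have [nb|nb] := ole_or_olt (g n) b.
  by exists (pickle (n, None : option nat)); rewrite pickleK; split.
have [m h] := hf n b nb.
by exists (pickle (n, Some m)); rewrite pickleK.
Qed.

Lemma ocountable_succ a : ocountable a -> ocountable (osucc a).
Proof.
move=> ca; apply: ocountable_ole (ocountable_osup (fun n : nat => ca)).
exact/ole_succ/(@olt_osup nat _ 0%N).
Qed.

Lemma ocountable_zero : ocountable ozero.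
Proof. by exists (fun=> ozero) => b /olt_zero. Qed.

(** * Continuity on products in terms of coordinates *)

Section PointwiseTopology.
Context {R : realType}.

Lemma ptws_proj_continuous (I : Type) (T : I -> topologicalType) i :
  continuous (fun f : prod_topology T => f i).
Proof.
move=> f; have /cvg_sup/(_ i) h : nbhs f --> f by exact: cvg_id.
apply: cvg_trans (@initial_continuous _ (T i) (fun g : prod_topology T => g i) f).
exact: cvg_app.
Qed.

(** A sequence contradicting the claim, within [1/(k+1)] of [x] in every coordinate, would converge
    to [x] in the product topology. *)
Lemma within_ptws_eps (m : nat) (D : set {ptws 'I_m -> R}) (f : ('I_m -> R) -> R) :
  {within D, continuous (f : {ptws 'I_m -> R} -> R)} ->
  forall x : 'I_m -> R, D x -> forall e : R, 0 < e -> exists2 d : R, 0 < d &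
    forall y : 'I_m -> R, D y -> (forall i, `|x i - y i| < d) -> `|f x - f y| < e.
Proof.
move=> /subspace_continuousP cf x Dx e e0; apply: contrapT => h.
have /choice[y hy] : forall k : nat, exists y : 'I_m -> R, [/\ D y,
    forall i, `|x i - y i| < k.+1%:R^-1 & ~ `|f x - f y| < e].
  move=> k; apply: contrapT => /forallNP hk; apply: h.
  exists k.+1%:R^-1 => [|y Dy xy]; first by rewrite invr_gt0.
  by apply: contrapT => fxy; apply: (hk y); split.
have cy : (y : nat -> {ptws 'I_m -> R}) @ \oo --> (x : {ptws 'I_m -> R}).
  apply/cvg_sup => i U [V] [[W] oW <-] WxN WU.
  suff : \forall k \near \oo, W (y k i) by apply: filterS => k; exact: WU.
  have /nbhs_ballP[d /= d0 dW] : nbhs (x i) W by exact: open_nbhs_nbhs.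
  near=> k; apply: dW; have [_ + _] := hy k => /(_ i) xy.
  apply: (lt_trans xy); near: k; exact: near_infty_natSinv_lt (PosNum d0).
have : \forall k \near \oo, ball (f x) e (f (y k)).
  have := cf x Dx (ball (f x) e) (nbhsx_ballx _ _ e0).
  rewrite /= /within /= nbhs_simpl => hW.
  have hk : \forall k \near \oo, D (y k) -> ball (f x) e (f (y k)) by exact: cy _ hW.
  by apply: filterS hk => k; apply; have [] := hy k.
move=> [N _ /(_ N (leqnn _))]; have [_ _] := hy N; exact.
Unshelve. all: by end_near. Qed.

(** A basic neighbourhood constrains finitely many coordinates, here those of [s]; this form serves
    infinite index sets such as [nat] as well. *)
Lemma ptws_eps_within (I : eqType) (D : set {ptws I -> R}) (f : (I -> R) -> R) :
  (forall x : I -> R, D x -> forall e : R, 0 < e -> exists2 d : R, 0 < d &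
    exists s : seq I, forall y : I -> R, D y ->
      (forall i, i \in s -> `|x i - y i| < d) -> `|f x - f y| < e) ->
  {within D, continuous (f : {ptws I -> R} -> R)}.
Proof.
move=> h; apply/subspace_continuousP => x Dx.
apply/cvgrPdist_lt => e e0; have [d d0 [s hs]] := h x Dx e e0.
change (\forall y \near (x : {ptws I -> R}), D y -> `|f x - f y| < e).
suff : \forall y \near (x : {ptws I -> R}), forall i, i \in s -> `|x i - y i| < d.
  move=> near_s; apply: (@filterS _ (nbhs (x : {ptws I -> R})) _ _ _ _ near_s).
  by move=> y hy Dy; exact: (hs y Dy hy).
elim: s {hs} => [|i s IH]; first exact: (@nearW _ (nbhs (x : {ptws I -> R}))).
have xi : \forall y \near (x : {ptws I -> R}), `|x i - y i| < d.
  by have /cvgrPdist_lt := @ptws_proj_continuous I (fun=> R) i x; apply.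
apply: (@filterS2 _ (nbhs (x : {ptws I -> R})) _ _ _ _ _ IH xi) => y hy hi j.
by rewrite in_cons => /orP[/eqP->//|]; exact: hy.
Qed.

(** The real [sup] of an unbounded set is a default value; this bound is what gives [conn_modulus]
    its meaning on a compact box. *)
Lemma compact_within_bounded (m : nat) (D : set {ptws 'I_m -> R}) (f : ('I_m -> R) -> R) :
  compact D -> {within D, continuous (f : {ptws 'I_m -> R} -> R)} ->
  exists M, forall x, D x -> `|f x| <= M.
Proof.
move=> cD cf; have /compact_bounded[M [_ hM]] := continuous_compact cf cD.
exists (M + 1) => x Dx; apply: hM; first by rewrite ltrDl.
by exists x.
Qed.

End PointwiseTopology.

(** * Moduli *)

Section Moduli.
Context {R : realType}.

Lemma modulus_mono (I : Type) (Delta : (I -> R) -> R) (x y : I -> R) :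
  is_modulus Delta -> orthant x -> (forall i, x i <= y i) -> Delta x <= Delta y.
Proof.
move=> mD x0 xy; have -> : y = (fun i => x i + (y i - x i)).
  by apply/funext => i; rewrite addrC subrK.
by apply: modulus_le => // i; rewrite subr_ge0.
Qed.

Lemma modulus_small n (Delta : ('I_n -> R) -> R) : is_modulus Delta ->
  forall e : R, 0 < e -> exists2 d : R, 0 < d &
  forall x : 'I_n -> R, orthant x -> (forall i : 'I_n, x i < d) -> Delta x < e.
Proof.
move=> mD e e0; have o0 : orthant ((fun=> 0) : 'I_n -> R) by move=> i.
have [d d0 h] := within_ptws_eps (modulus_cont mD) o0 e0.
exists d => // x x0 xd; have := h x x0; rewrite modulus0// sub0r normrN.
move=> /(_ _)/(le_lt_trans (ler_norm _)); apply => i.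
by rewrite sub0r normrN ger0_norm.
Qed.

Section Connective.
Variables (m : nat) (f : ('I_m -> R) -> R) (D : set {ptws 'I_m -> R}).

Lemma conn_modulus_ub (M : R) (x y : 'I_m -> R) (delta : 'I_m -> R) :
  (forall x, D x -> `|f x| <= M) -> D x -> D y ->
  (forall i, `|x i - y i| <= delta i) -> `|f x - f y| <= conn_modulus f D delta.
Proof.
move=> fM Dx Dy xy; apply: ub_le_sup; last by exists x, y.
exists (M + M) => _ [x' [y' [Dx' Dy' _ ->]]].
by rewrite (le_trans (ler_normB _ _))// lerD ?fM.
Qed.

Lemma conn_modulus_le (delta : 'I_m -> R) c : 0 <= c ->
  (forall x y : 'I_m -> R, D x -> D y -> (forall i, `|x i - y i| <= delta i) ->
     `|f x - f y| <= c) ->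
  conn_modulus f D delta <= c.
Proof.
move=> c0 h; rewrite /conn_modulus; set S := [set _ | _].
(* The supremum of the empty set is 0 by convention, hence the hypothesis [0 <= c]. *)
have [->|/set0P S0] := eqVneq S set0; first by rewrite sup0.
by apply: ge_sup => // _ [x [y [Dx Dy xy ->]]]; exact: h.
Qed.
End Connective.

Section WeakModulus.
Variable Omega : (nat -> R) -> \bar R.
Hypothesis wO : is_weak_modulus Omega.
Local Notation restr := (weak_modulus_restr Omega).

Lemma restr_orthant n (x : nat -> R) : orthant x ->
  orthant (fun i => if (i < n)%N then x i else 0).
Proof. by move=> x0 i; case: ifP. Qed.

Lemma weak_modulus_mono (x y : nat -> R) :
  orthant x -> (forall i, x i <= y i) -> (Omega x <= Omega y)%E.
Proof.
move=> x0 xy; have -> : y = (fun i => x i + (y i - x i)).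
  by apply/funext => i; rewrite addrC subrK.
by apply: weak_modulus_le => // i; rewrite subr_ge0.
Qed.

Lemma restr_mono n (x y : nat -> R) :
  orthant x -> (forall i, (i < n)%N -> x i <= y i) -> (restr n x <= restr n y)%E.
Proof.
move=> x0 xy; apply: weak_modulus_mono; first exact: restr_orthant.
by move=> i; case: ifP => // /xy.
Qed.

Lemma restr_ext n (x y : nat -> R) :
  (forall i, (i < n)%N -> x i = y i) -> restr n x = restr n y.
Proof.
by move=> xy; congr Omega; apply/funext => i; case: ifP => // /xy.
Qed.

Lemma restr_leS n (x : nat -> R) : orthant x -> (restr n x <= restr n.+1 x)%E.
Proof.
move=> x0; apply: weak_modulus_mono; first exact: restr_orthant.
by move=> i; case: ltnP => [/ltnW h|]; [rewrite ltnS h|case: ifP].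
Qed.

Lemma restrS_0 n (x : nat -> R) : x n = 0 -> restr n.+1 x = restr n x.
Proof.
move=> xn; congr Omega; apply/funext => i; rewrite ltnS leq_eqVlt.
by case: eqVneq => [->|]//=; rewrite ltnn.
Qed.

Lemma restr_eq0 n (x : nat -> R) : (forall i, (i < n)%N -> x i = 0) -> restr n x = 0%E.
Proof.
move=> x0; rewrite -(weak_modulus0 wO); congr Omega.
by apply/funext => i; case: ifP => // /x0.
Qed.

Lemma restr_ge0 n (x : nat -> R) : orthant x -> (0 <= restr n x)%E.
Proof. by move=> x0; exact: (weak_modulus_ge0 wO (restr_orthant n x0)). Qed.

Lemma restr_sub n (x y : nat -> R) : orthant x -> orthant y ->
  (restr n (fun i => x i + y i)%R <= restr n x + restr n y)%E.
Proof.
move=> x0 y0.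
have := weak_modulus_sub wO (restr_orthant n x0) (restr_orthant n y0).
apply: le_trans.
rewrite le_eqVlt; apply/orP; left; apply/eqP; congr Omega.
by apply/funext => i; case: ifP => //; rewrite addr0.
Qed.

(** Subadditivity splits off the last coordinate, where separate continuity at 0 applies; so [Omega]
    is jointly continuous at 0 in finitely many coordinates. *)
Lemma restr_small n (e : R) : 0 < e -> exists2 d : R, 0 < d &
  forall x : nat -> R, orthant x -> (forall i, (i < n)%N -> x i < d) -> (restr n x <= e%:E)%E.
Proof.
elim: n e => [|n IH] e e0.
  by exists 1 => // x x0 _; rewrite restr_eq0// lee_fin ltW.
have e20 : 0 < e / 2 by rewrite divr_gt0.
have [d1 d10 h1] := IH _ e20.
have oz : orthant ((fun=> 0) : nat -> R) by move=> i.
have /subspace_continuousP/(_ 0) := @weak_modulus_sep _ _ wO _ n oz.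
have z0 : [set` `[0, +oo[] (0 : R) by rewrite /= in_itv /= lexx.
rewrite /from_subspace => /(_ z0).
have -> : [eta (fun=> 0) with n |-> 0] = (fun=> 0) :> (nat -> R).
  by apply/funext => i /=; case: ifP.
rewrite weak_modulus0// => /(_ [set x | (x < (e / 2)%:E)%E]).
case.
  apply: open_nbhs_nbhs; split; last by rewrite /= lte_fin.
  exact: open_ereal_lt_ereal.
move=> d2 /= d20 h2.
exists (Num.min d1 d2) => [|x x0 xd]; first by rewrite lt_min d10.
pose xn : nat -> R := [eta (fun=> 0) with n |-> x n].
have xn0 : orthant xn by move=> i; rewrite /xn /=; case: ifP.
apply: (@le_trans _ _ (restr n x + Omega xn)%E).
  apply: le_trans (weak_modulus_sub wO (restr_orthant n x0) xn0).
  rewrite le_eqVlt; apply/orP; left; apply/eqP; congr Omega.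
  apply/funext => i; rewrite /xn /= ltnS leq_eqVlt.
  by case: eqVneq => [->|_]/=; rewrite ?ltnn ?add0r ?addr0.
rewrite (splitr e) EFinD leeD//.
  by apply: h1 => // i ni; rewrite (lt_le_trans (xd i _)) ?ge_min ?lexx ?(ltn_trans ni).
have := h2 (x n); rewrite /= sub0r normrN ger0_norm// => h.
apply/ltW/h; last by rewrite in_itv /= andbT; exact: x0.
by rewrite (lt_le_trans (xd n _)) ?ge_min ?lexx ?orbT.
Qed.

(** [Omega] may be infinite even on finitely many arguments, while formulas carry real moduli. The
    cut-off is harmless for formulas with values in [[0, 1]]. *)
Definition trunc_modulus n (x : nat -> R) : R := fine (mine 1%E (restr n x)).

Lemma trunc_modulusE n x : orthant x ->
  (trunc_modulus n x)%:E = mine 1%E (restr n x).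
Proof.
move=> x0; rewrite fineK// fin_numElt; have := restr_ge0 n x0.
case: (restr n x) => [r| |]//=; rewrite /mine; last by case: ifP; rewrite ?ltNyr ?ltry.
by case: ifP; rewrite ?ltNyr ?ltry.
Qed.

Lemma trunc_modulus_le n x : orthant x -> trunc_modulus n x <= 1.
Proof. by move=> x0; rewrite -lee_fin trunc_modulusE// ge_min lexx. Qed.

Lemma le_trunc_modulus n x (c : R) : orthant x -> c <= 1 ->
  (c%:E <= restr n x)%E -> c <= trunc_modulus n x.
Proof. by move=> x0 c1 h; rewrite -lee_fin trunc_modulusE// le_min lee_fin c1. Qed.

Lemma trunc_modulus_le_restr n x : orthant x -> ((trunc_modulus n x)%:E <= restr n x)%E.
Proof. by move=> x0; rewrite trunc_modulusE// ge_min lexx orbT. Qed.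

Lemma trunc_modulus_mono n (x y : nat -> R) : orthant x ->
  (forall i, (i < n)%N -> x i <= y i) -> trunc_modulus n x <= trunc_modulus n y.
Proof.
move=> x0 xy.
have -> : trunc_modulus n y = trunc_modulus n (fun i => if (i < n)%N then y i else 0).
  by congr (fine (mine _ _)); apply: restr_ext => i ->.
apply: le_trunc_modulus; first by move=> i; case: ifP => // /xy; exact: le_trans.
  exact: trunc_modulus_le.
apply: le_trans (trunc_modulus_le_restr n x0) _; apply: restr_mono => // i ni.
by rewrite ni xy.
Qed.

(** Failure would force both values on the right below 1, where they are not truncated, against the
    subadditivity of [Omega]. *)
Lemma trunc_modulus_sub n (x y : nat -> R) : orthant x -> orthant y ->
  trunc_modulus n (fun i => x i + y i) <= trunc_modulus n x + trunc_modulus n y.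
Proof.
move=> x0 y0; have xy0 : orthant (fun i => x i + y i) by move=> i; rewrite addr_ge0.
have ge0 z : orthant z -> 0 <= trunc_modulus n z.
  by move=> z0; apply: le_trunc_modulus => //; exact: restr_ge0.
rewrite leNgt; apply/negP => h.
have t1 := trunc_modulus_le n xy0; have tx := ge0 _ x0; have ty := ge0 _ y0.
have f (z : nat -> R) : orthant z -> trunc_modulus n z < 1 -> restr n z = (trunc_modulus n z)%:E.
  move=> z0; rewrite -lte_fin trunc_modulusE// /mine.
  by case: ifP => //; rewrite ltxx.
have := restr_sub n x0 y0; rewrite (f x)// ?(f y)//; [|lra|lra].
by move=> /(le_trans (trunc_modulus_le_restr n xy0)); rewrite -EFinD lee_fin leNgt h.
Qed.

Lemma trunc_modulus_small n (e : R) : 0 < e -> exists2 d : R, 0 < d &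
  forall x : nat -> R, orthant x -> (forall i, (i < n)%N -> x i < d) -> trunc_modulus n x <= e.
Proof.
move=> e0; have [d d0 h] := restr_small n e0; exists d => // x x0 xd.
by rewrite -lee_fin (le_trans (trunc_modulus_le_restr n x0))// h.
Qed.

Lemma trunc_modulus_eq0 n x : (forall i, (i < n)%N -> x i = 0) -> trunc_modulus n x = 0.
Proof.
by move=> h; rewrite /trunc_modulus restr_eq0// /mine lte_fin ltNge ler01.
Qed.

Lemma trunc_modulusP n : is_modulus (trunc_modulus n).
Proof.
have ge0 x : orthant x -> 0 <= trunc_modulus n x.
  by move=> x0; apply: le_trunc_modulus => //; exact: restr_ge0.
split=> //.
- exact: trunc_modulus_eq0.
- by move=> x y x0 y0; apply: trunc_modulus_mono => // i _; rewrite lerDl.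
- exact: trunc_modulus_sub.
- apply: ptws_eps_within => x x0 e e0.
  have e20 : 0 < e / 2 by rewrite divr_gt0.
  have [d d0 h] := trunc_modulus_small n e20.
  exists d => //; exists (iota 0 n) => y y0 xy.
  (* Subadditivity reduces continuity at [x] to smallness of the modulus at the coordinatewise
     differences. *)
  pose z (i : nat) := `|x i - y i|; have z0 : orthant z by move=> i; rewrite /z.
  have tz : trunc_modulus n z <= e / 2.
    by apply: h => // i ni; apply: xy; rewrite mem_iota.
  have xyz (u v : nat -> R) : orthant u -> orthant v ->
      (forall i, u i <= v i + z i) -> trunc_modulus n u <= trunc_modulus n v + e / 2.
    move=> u0 v0 uv; apply: le_trans (lerD (lexx _) tz).
    apply: le_trans (trunc_modulus_sub n v0 z0).
    by apply: trunc_modulus_mono => // i _.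
  have h1 : trunc_modulus n x <= trunc_modulus n y + e / 2.
    by apply: xyz => // i; rewrite -lerBlDl ler_norm.
  have h2 : trunc_modulus n y <= trunc_modulus n x + e / 2.
    by apply: xyz => // i; rewrite -lerBlDl /z distrC ler_norm.
  by rewrite ltr_norml; apply/andP; split; lra.
Qed.

End WeakModulus.
End Moduli.

Lemma ereal_le_real {R : realType} (u v : \bar R) :
  (forall x : R, (v <= x%:E)%E -> (u <= x%:E)%E) -> (u <= v)%E.
Proof.
case: v => [r| |] h; [exact: h|exact: leey|].
case: u h => [r| |] // h.
  by have := h (r - 1) (leNye _); rewrite lee_fin lerBrDr gerDl ler10.
by have := h 0 (leNye _).
Qed.

(** * Tuples, valuations and the evaluation of basic formulas *)

Section Valuations.
Context {A : pointedType}.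

Definition prefix_tuple n (v : nat -> A) : n.-tuple A := [tuple v i | i < n].

Lemma nth_prefix_tuple n v i : (i < n)%N -> nth point (prefix_tuple n v) i = v i.
Proof. by move=> ni; rewrite -[i]/(val (Ordinal ni)) nth_mktuple. Qed.

Lemma prefix_tuple_nth n (a : n.-tuple A) : prefix_tuple n (nth point a) = a.
Proof. by apply: eq_from_tnth => i; rewrite tnth_mktuple (tnth_nth point). Qed.

Lemma nth_rcons_tuple n (a : n.-tuple A) c i :
  nth point (rcons_tuple a c) i =
  if (i < n)%N then nth point a i else if i == n then c else point.
Proof. by rewrite /= nth_rcons size_tuple. Qed.

Lemma rcons_prefix_tuple n v c :
  rcons_tuple (prefix_tuple n v) c = prefix_tuple n.+1 [eta v with n |-> c].
Proof.
apply: eq_from_tnth => i; rewrite tnth_mktuple (tnth_nth point) nth_rcons_tuple /=.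
have := ltn_ord i; rewrite ltnS leq_eqVlt.
case: eqVneq => [->|ne /= ni]; first by rewrite ltnn.
by rewrite ni nth_prefix_tuple.
Qed.

End Valuations.

Section Evaluation.
Context {R : realType} {L : signature R}.
Implicit Types (A B C : structure L).

Lemma pmodP (P : pred_symbol L) : is_modulus (@pmod R L P).
Proof.
case: P => [|P]; last exact: psym_modP.
split=> /=.
- by rewrite addr0.
- by move=> x x0; rewrite addr_ge0.
- by move=> x y x0 y0; rewrite lerD// lerDl.
- by move=> x y x0 y0; rewrite addrACA.
- apply: ptws_eps_within => x _ e e0; exists (e / 2); first by rewrite divr_gt0.
  exists [:: ord0; ord_max] => y _ h.
  by rewrite opprD addrACA (le_lt_trans (ler_normD _ _))// (splitr e) ltrD// h.
Qed.

Lemma mdist_orthant A (I : Type) (x y : I -> A) : orthant (fun i => mdist (x i) (y i)).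
Proof. by move=> i; exact: mdist_ge0. Qed.

Lemma pint_bound A P (x : 'I_(parity P) -> A) : pbound P (pint x).
Proof. by case: P x => [|P] x; [exact: dist_bound|exact: psym_int_bound]. Qed.

Lemma mdist_lipschitz A (x y x' y' : A) :
  `|mdist x y - mdist x' y'| <= mdist x x' + mdist y y'.
Proof.
have h (u v u' v' : A) : mdist u v - mdist u' v' <= mdist u u' + mdist v v'.
  rewrite lerBlDr (le_trans (metric_triangle u u' v))// -addrA lerD2l.
  by rewrite addrC (metric_sym v) metric_triangle.
rewrite ler_norml h andbT lerNl opprB.
by rewrite (le_trans (h _ _ _ _))// (metric_sym x') (metric_sym y').
Qed.

Lemma pint_respects A P (x y : 'I_(parity P) -> A) :
  `|pint x - pint y| <= pmod (fun i => mdist (x i) (y i)).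
Proof.
by case: P x y => [|P] x y; [exact: mdist_lipschitz|exact: psym_int_respects].
Qed.

Lemma teval_respects A (v w : nat -> A) (t : term L) :
  mdist (teval v t) (teval w t) <= tmodulus t (fun i => mdist (v i) (w i)).
Proof.
elim: t => [i|F tau IH] //=; apply: le_trans (fint_respects _ _) _.
by apply: modulus_mono => //; [exact: fmodP|exact: mdist_orthant].
Qed.

Lemma atom_respects A (v w : nat -> A) P (tau : 'I_(parity P) -> term L) :
  `|eval v (Atom tau) - eval w (Atom tau)| <=
    modulus (Atom tau) (fun i => mdist (v i) (w i)).
Proof.
apply: le_trans (pint_respects _ _) _.
apply: modulus_mono; [exact: pmodP|exact: mdist_orthant|].
by move=> i; exact: teval_respects.
Qed.

Lemma teval_ext A (v w : nat -> A) t :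
  (forall i, tfv t i -> v i = w i) -> teval v t = teval w t.
Proof.
elim: t => [i h|F tau IH h] /=; first exact: h.
by congr fint; apply/funext => k; apply: IH => i ti; apply: h; exists k.
Qed.

Section BasicFormula.
Variables (m : nat) (f : ('I_m -> R) -> R) (P : 'I_m -> pred_symbol L)
  (tau : forall i, 'I_(parity (P i)) -> term L).
Let psi i := Atom (@tau i).

Lemma basic_eval_ext A (v w : nat -> A) :
  (forall i, fv (Conn f psi) i -> v i = w i) ->
  eval v (Conn f psi) = eval w (Conn f psi).
Proof.
move=> h /=; congr f; apply/funext => i; congr pint; apply/funext => k.
by apply: teval_ext => j tj; apply: h; exists i => //; exists k.
Qed.

Lemma box_eval A (v : nat -> A) : box psi (fun i => eval v (psi i)).
Proof. by move=> i; exact: pint_bound. Qed.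

Lemma box_atoms_compact : compact (box psi).
Proof.
apply: (@tychonoff 'I_m (fun=> R) (fun i => pbound (P i))) => i.
by rewrite /pbound; case: (P i) => [|Q]; exact: segment_compact.
Qed.

Hypothesis cf : {within box psi, continuous (f : {ptws 'I_m -> R} -> R)}.

Lemma basic_conn_respects (x y : 'I_m -> R) (delta : 'I_m -> R) :
  box psi x -> box psi y -> (forall i, `|x i - y i| <= delta i) ->
  `|f x - f y| <= conn_modulus f (box psi) delta.
Proof.
have [M hM] := compact_within_bounded box_atoms_compact cf.
exact: conn_modulus_ub hM.
Qed.

Lemma basic_eval_respects A (v w : nat -> A) :
  `|eval v (Conn f psi) - eval w (Conn f psi)| <=
    modulus (Conn f psi) (fun i => mdist (v i) (w i)).
Proof.
apply: basic_conn_respects; [exact: box_eval|exact: box_eval|].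
by move=> i; exact: atom_respects.
Qed.

End BasicFormula.
End Evaluation.

(** * Back-and-forth distances *)

(** Trees representing the same ordinal need not be equal, so invariance under [oeq] is a
    hypothesis; then only the canonical zero and successors have to be treated. *)
Lemma ord_ind3 (P : Ord -> Prop) :
  (forall a b, oeq a b -> P a -> P b) -> P ozero -> (forall a, P a -> P (osucc a)) ->
  (forall a, olimit a -> (forall b, olt b a -> P b) -> P a) -> forall a, P a.
Proof.
move=> Pe P0 PS Pl a; elim/(well_founded_induction olt_wf): a => a IH.
have [a0|[[b ab]|la]] := ord_cases a.
- by apply: Pe P0; exact: oeq_sym.
- apply: Pe (oeq_sym ab) _; apply/PS/IH; exact: olt_oeq_succ ab.
- exact: Pl.
Qed.

Section BackAndForth.
Context {R : realType} {L : signature R} {Omega : (nat -> R) -> \bar R}.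
Hypothesis wO : is_weak_modulus Omega.
Implicit Types (A B C : structure L).

(** Real upper bounds turn suprema into universal quantifiers and infima into existential ones up to
    an error, so that infinite values never enter the arithmetic. *)
Definition bfle A B alpha n (a : n.-tuple A) (b : n.-tuple B) (x : R) : Prop :=
  (bf Omega alpha a b <= x%:E)%E.

Lemma bfle_oeq A B alpha beta n (a : n.-tuple A) (b : n.-tuple B) x :
  oeq alpha beta -> bfle alpha a b x -> bfle beta a b x.
Proof. by move=> /(bf_oeq Omega A B) e; rewrite /bfle e. Qed.

Local Notation basics := (@basic_formulas R L Omega).

Lemma bfle_zero A B n (a : n.-tuple A) (b : n.-tuple B) x :
  bfle ozero a b x <-> forall phi, basics n phi ->
    `|interp a phi - interp b phi| <= x.
Proof.
rewrite /bfle bf_zero; split=> [h phi bphi|h].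
  by rewrite -lee_fin; apply: le_trans h; apply: ereal_sup_ubound; exists phi.
by apply: ge_ereal_sup => _ [phi bphi <-]; rewrite lee_fin; exact: h.
Qed.

(** In the maximum one term involves only [c] and its answer, the other only [d] and its answer, so
    the game separates into a forth and a back condition. The infimum need not be attained, whence
    [e]. *)
Lemma bfle_succ A B alpha n (a : n.-tuple A) (b : n.-tuple B) x :
  bfle (osucc alpha) a b x <->
  (forall c e, 0 < e -> exists d, bfle alpha (rcons_tuple a c) (rcons_tuple b d) (x + e)) /\
  (forall d e, 0 < e -> exists c, bfle alpha (rcons_tuple a c) (rcons_tuple b d) (x + e)).
Proof.
rewrite /bfle bf_succ; split=> [h|[hA hB]].
  have {}h c d e : 0 < e -> exists c' d',
      bfle alpha (rcons_tuple a c) (rcons_tuple b d') (x + e) /\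
      bfle alpha (rcons_tuple a c') (rcons_tuple b d) (x + e).
    move=> e0; have xe : (x%:E < (x + e)%:E)%E by rewrite lte_fin ltrDl.
    have {}h := le_trans (ereal_sup_ubound (ex_intro2 _ _ (c, d) I erefl)) h.
    have [_ [[c' d'] _ <-] /ltW] := ereal_inf_lt (le_lt_trans h xe).
    by rewrite ge_max => /andP[h1 h2]; exists c', d'.
  split=> [c e e0|d e e0].
    by have [_ [d [hd _]]] := h c point e e0; exists d.
  by have [c [_ [_ hc]]] := h point d e e0; exists c.
apply: ge_ereal_sup => _ [[c d] _ <-]; apply/lee_addgt0Pr => e e0 /=.
have [d' hd] := hA c e e0; have [c' hc] := hB d e e0.
apply: (@le_trans _ _ (maxe (bf Omega alpha (rcons_tuple a c) (rcons_tuple b d'))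
  (bf Omega alpha (rcons_tuple a c') (rcons_tuple b d)))).
  by apply: ereal_inf_lbound; exists (c', d').
by rewrite ge_max -EFinD; apply/andP.
Qed.

Lemma bfle_limit A B alpha n (a : n.-tuple A) (b : n.-tuple B) x : olimit alpha ->
  bfle alpha a b x <-> forall beta, olt beta alpha -> bfle beta a b x.
Proof.
move=> la; rewrite /bfle bf_limit//; split=> [h beta ba|h].
  by apply: le_trans h; apply: ereal_sup_ubound; exists beta.
by apply: ge_ereal_sup => _ [beta ba <-]; exact: h.
Qed.

Lemma bfle_le A B alpha n (a : n.-tuple A) (b : n.-tuple B) x y :
  x <= y -> bfle alpha a b x -> bfle alpha a b y.
Proof. by rewrite -lee_fin => xy h; exact: le_trans h xy. Qed.

Lemma bfle_closed A B alpha n (a : n.-tuple A) (b : n.-tuple B) x :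
  (forall e, 0 < e -> bfle alpha a b (x + e)) -> bfle alpha a b x.
Proof. by move=> h; apply/lee_addgt0Pr => e /h. Qed.

Lemma bf_eqP A B alpha beta n (a : n.-tuple A) (b : n.-tuple B) :
  bf Omega alpha a b = bf Omega beta a b <->
  forall x, bfle alpha a b x <-> bfle beta a b x.
Proof.
rewrite /bfle; split=> [->//|h]; apply/le_anti/andP; split.
  by apply: ereal_le_real => x /h.
by apply: ereal_le_real => x /h.
Qed.

Lemma basics_interp_rcons A n (a : n.-tuple A) c phi :
  basics n phi -> interp (rcons_tuple a c) phi = interp a phi.
Proof.
move=> [[m [f [P [tau ->]]]] _ fvn _]; apply: basic_eval_ext => i /fvn /= ni.
by rewrite nth_rcons size_tuple ni.
Qed.

Lemma basicsS n phi : basics n phi -> basics n.+1 phi.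
Proof.
move=> [b w fvn mn]; split=> // [i /fvn /= ni|x x0]; first exact: ltnW.
exact: le_trans (mn x x0) (restr_leS wO n x0).
Qed.

Lemma bfle_succ_le A B alpha n (a : n.-tuple A) (b : n.-tuple B) x :
  bfle (osucc alpha) a b x -> bfle alpha a b x.
Proof.
elim/ord_ind3: alpha n a b x => [alpha beta ab IH|||alpha la IH] n.
- move=> a b x /(bfle_oeq (oeq_succ (oeq_sym ab)))/IH; exact: bfle_oeq.
- move=> a b x /bfle_succ[h _]; apply: bfle_closed => e e0.
  have [d /bfle_zero hd] := h point e e0.
  apply/bfle_zero => phi bphi; have := hd _ (basicsS bphi).
  by rewrite !basics_interp_rcons.
- move=> IH m a b x /bfle_succ[hA hB]; apply/bfle_succ; split.
    by move=> c e /(hA c)[d /IH ?]; exists d.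
  by move=> d e /(hB d)[c /IH ?]; exists c.
- move=> a b x /bfle_succ[hA hB]; apply/bfle_limit => // beta ba.
  apply: IH => //; apply/bfle_succ; split.
    by move=> c e /(hA c)[d /(bfle_limit _ _ _ la)/(_ _ ba) ?]; exists d.
  by move=> d e /(hB d)[c /(bfle_limit _ _ _ la)/(_ _ ba) ?]; exists c.
Qed.

Lemma bfle_mono A B alpha beta n (a : n.-tuple A) (b : n.-tuple B) x :
  ole alpha beta -> bfle beta a b x -> bfle alpha a b x.
Proof.
elim/ord_ind3: beta alpha n a b x => [beta beta' bb IH|||beta lb IH] alpha.
- move=> n a b x ab /(bfle_oeq (oeq_sym bb)); apply: IH.
  exact: ole_trans ab bb.2.
- move=> n a b x a0; apply: bfle_oeq; split=> //; exact: ole_zero.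
- move=> IH gamma n a b x ga h; have [gle|glt] := ole_or_olt gamma alpha.
    exact: IH gle (bfle_succ_le h).
  by apply: bfle_oeq h; split=> //; apply/ole_succ.
- move=> n a b x ab h; have [ba|ab'] := ole_or_olt beta alpha.
    by apply: bfle_oeq h; split.
  by move/(bfle_limit _ _ _ lb): h; apply.
Qed.

(** A connective with no arguments. It keeps the supremum at stage 0 from being taken over the empty
    set, which would give a negative infinite value. *)
Lemma basics_nonempty n : exists phi, basics n phi.
Proof.
pose P (i : 'I_0) : pred_symbol L := Dist L.
pose tau (i : 'I_0) : 'I_(parity (P i)) -> term L := fun=> Var L 0.
exists (@Conn R L 0 (fun=> 0) (fun i => Atom (@tau i))); split.
- by exists 0%N, (fun=> 0), P, tau.
- split=> [[]//|]; move=> ?; exact: cvg_cst.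
- by move=> i [[]].
- move=> x x0; apply: le_trans (restr_ge0 wO n x0); rewrite lee_fin.
  by apply: conn_modulus_le => // y z _ _ _; rewrite subrr normr0.
Qed.

Lemma bfle_ge0 A B alpha n (a : n.-tuple A) (b : n.-tuple B) x :
  bfle alpha a b x -> 0 <= x.
Proof.
move=> /(bfle_mono (ole_zero alpha))/bfle_zero h.
have [phi /h] := basics_nonempty n; exact: le_trans.
Qed.

Lemma bfle_sym A B alpha n (a : n.-tuple A) (b : n.-tuple B) x :
  bfle alpha a b x -> bfle alpha b a x.
Proof.
elim/ord_ind3: alpha n a b x => [alpha beta ab IH|||alpha la IH] n.
- move=> a b x /(bfle_oeq (oeq_sym ab))/IH; exact: bfle_oeq.
- move=> a b x /bfle_zero h; apply/bfle_zero => phi /h; by rewrite distrC.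
- move=> IH m a b x /bfle_succ[hA hB]; apply/bfle_succ; split.
    by move=> c e /(hB c)[d /IH ?]; exists d.
  by move=> d e /(hA d)[c /IH ?]; exists c.
- move=> a b x h; apply/bfle_limit => // beta ba; apply: IH => //.
  by move/(bfle_limit _ _ _ la): h; apply.
Qed.

(** The answer given in the middle structure in one game is played as a move in the other; each game
    takes half of the error. *)
Lemma bfle_triangle A B C alpha n (a : n.-tuple A) (b : n.-tuple B) (c : n.-tuple C) x y :
  bfle alpha a b x -> bfle alpha b c y -> bfle alpha a c (x + y).
Proof.
elim/ord_ind3: alpha n a b c x y => [alpha beta ab IH|||alpha la IH] n.
- move=> a b c x y /(bfle_oeq (oeq_sym ab)) h1 /(bfle_oeq (oeq_sym ab)) h2.
  exact: bfle_oeq ab (IH _ _ _ _ _ _ h1 h2).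
- move=> a b c x y /bfle_zero h1 /bfle_zero h2; apply/bfle_zero => phi bphi.
  by rewrite (le_trans (ler_distD (interp b phi) _ _))// lerD ?h1 ?h2.
- move=> IH m a b c x y /bfle_succ[hA hB] /bfle_succ[hB' hC]; apply/bfle_succ.
  split=> u e e0; have e20 : 0 < e / 2 by rewrite divr_gt0.
    have [v hv] := hA u _ e20; have [w hw] := hB' v _ e20; exists w.
    by rewrite (splitr e) addrACA; exact: IH hv hw.
  have [v hv] := hC u _ e20; have [w hw] := hB v _ e20; exists w.
  by rewrite (splitr e) addrACA; exact: IH hw hv.
- move=> a b c x y h1 h2; apply/bfle_limit => // beta ba; apply: (IH _ ba _ _ b).
    by move/(bfle_limit _ _ _ la): h1; apply.
  by move/(bfle_limit _ _ _ la): h2; apply.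
Qed.

(** Beyond the length both tuples read [point], so those coordinates vanish. *)
Definition tuple_dist A n (a a' : n.-tuple A) : nat -> R :=
  fun i => mdist (nth point a i) (nth point a' i).

Lemma tuple_dist_orthant A n (a a' : n.-tuple A) : orthant (tuple_dist a a').
Proof. exact: mdist_orthant. Qed.

(** At stage 0 this is what respecting [Omega] means for basic formulas. Later, each move is
    answered by the same point, which adds a zero coordinate. *)
Lemma bfle_self A alpha n (a a' : n.-tuple A) x :
  (weak_modulus_restr Omega n (tuple_dist a a') <= x%:E)%E -> bfle alpha a a' x.
Proof.
elim/ord_ind3: alpha n a a' x => [alpha beta ab IH|||alpha la IH] n.
- by move=> a a' x /IH; exact: bfle_oeq.
- move=> a a' x h; apply/bfle_zero => _ [[m [f [P [tau ->]]]] [_ cf] _ mn].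
  rewrite -lee_fin; apply: le_trans h.
  apply: le_trans (mn _ (tuple_dist_orthant a a')); rewrite lee_fin.
  exact: basic_eval_respects.
- move=> IH m a a' x h.
  have ext c e : 0 < e -> bfle n (rcons_tuple a c) (rcons_tuple a' c) (x + e).
    move=> e0; apply: IH; rewrite restrS_0.
      apply: (@le_trans _ _ x%:E); last by rewrite lee_fin lerDl ltW.
      apply: le_trans h; rewrite (@restr_ext _ _ _ _ (tuple_dist a a'))// => i im.
      by rewrite /tuple_dist !nth_rcons_tuple im.
    by rewrite /tuple_dist !nth_rcons_tuple ltnn eqxx mdistxx.
  by apply/bfle_succ; split=> c e e0; exists c; exact: ext.
- by move=> a a' x h; apply/bfle_limit => // beta ba; apply: IH.
Qed.

Lemma bfle_move A B alpha n (a a' : n.-tuple A) (b b' : n.-tuple B) x u v :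
  (weak_modulus_restr Omega n (tuple_dist a a') <= u%:E)%E ->
  (weak_modulus_restr Omega n (tuple_dist b b') <= v%:E)%E ->
  bfle alpha a b x -> bfle alpha a' b' (u + x + v).
Proof.
move=> ha hb h; apply: bfle_triangle (bfle_self alpha hb).
exact: bfle_triangle (bfle_sym (bfle_self alpha ha)) h.
Qed.

Definition stable A B alpha := forall n (a : n.-tuple A) (b : n.-tuple B) x,
  bfle alpha a b x -> bfle (osucc alpha) a b x.

(** Stability concerns tuples of all lengths, so the position after a move is again bounded at stage
    [lambda] and the induction hypothesis applies to it. *)
Lemma stable_forever A B lambda : stable A B lambda ->
  forall alpha n (a : n.-tuple A) (b : n.-tuple B) x,
  bfle lambda a b x -> bfle alpha a b x.
Proof.
move=> st; elim/ord_ind3 => [alpha beta ab IH|||alpha la IH] n.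
- by move=> a b x /IH; exact: bfle_oeq.
- move=> a b x; apply: bfle_mono; exact: ole_zero.
- move=> IH m a b x /st/bfle_succ[hA hB]; apply/bfle_succ; split.
    by move=> c e /(hA c)[d /IH ?]; exists d.
  by move=> d e /(hB d)[c /IH ?]; exists c.
- by move=> a b x h; apply/bfle_limit => // beta ba; apply: IH.
Qed.

Lemma bf_stableP A alpha : bf_stable Omega A alpha <-> stable A A alpha.
Proof.
split=> h n a b; first by move=> x; have [] := (bf_eqP _ _ _ _).1 (h n a b) x.
by apply/bf_eqP => x; split; [exact: h|exact: bfle_succ_le].
Qed.

End BackAndForth.

(** * Stabilisation at countable stages *)

Section ScottRank.
Context {R : realType} {L : signature R} {Omega : (nat -> R) -> \bar R}.
Hypothesis wO : is_weak_modulus Omega.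
Implicit Types (A B C : structure L).
Local Notation restr := (weak_modulus_restr Omega).
Local Notation bfle := (bfle (Omega := Omega)).

(** The index type is arbitrary so that the identity of a structure also counts as a dense
    family. *)
Definition dense_seq (I : Type) A (C : I -> A) : Prop :=
  forall x e, 0 < e -> exists k, mdist x (C k) < e.

Lemma dense_mdist A (D : set A) x (e : R) : dense D -> 0 < e ->
  exists2 y, D y & mdist x y < e.
Proof.
move=> dD e0; have [] := dD (ball x e)°.
- exists x; apply: nbhs_singleton; apply: nbhs_interior; exact: nbhsx_ballx.
- exact: open_interior.
move=> y [/interior_subset + Dy]; rewrite ballEmdist /= => xy.
by exists y.
Qed.

Lemma separable_dense_seq A : separable A -> exists C : nat -> A, dense_seq C.
Proof.
move=> [D cD dD].
have [C hC] : exists C : nat -> A, D `<=` range C.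
  move/countable_injP : cD => [f injf].
  have inv k : exists x, (exists2 y, D y & f y = k) -> D x /\ f x = k.
    by have [[y Dy <-]|h] := pselect (exists2 y, D y & f y = k); [exists y|exists point].
  have [C hC] := choice inv; exists C => x Dx; exists (f x) => //.
  have [DC e] : D (C (f x)) /\ f (C (f x)) = f x by apply: hC; exists x.
  by apply: injf => //; apply/mem_set.
exists C => x e e0; have [y /hC[k _ <-] xy] := dense_mdist x dD e0.
by exists k.
Qed.

Lemma dense_approx A (C : nat -> A) n (a : n.-tuple A) (e : R) : dense_seq C -> 0 < e ->
  exists j : n.-tuple nat, (restr n (tuple_dist a (map_tuple C j)) <= e%:E)%E.
Proof.
move=> dC e0; have [d d0 h] := restr_small wO n e0.
have /choice[j hj] i := dC (nth point a i) d d0.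
exists (mktuple (fun i : 'I_n => j i)); apply: h; first exact: tuple_dist_orthant.
move=> i ni; rewrite /tuple_dist (nth_map 0%N) ?size_tuple//.
by rewrite -[i]/(val (Ordinal ni)) nth_mktuple.
Qed.

Lemma map_rcons_tuple (T U : Type) (f : T -> U) n (j : n.-tuple T) k :
  map_tuple f (rcons_tuple j k) = rcons_tuple (map_tuple f j) (f k).
Proof. by apply: val_inj; rewrite /= map_rcons. Qed.

(* An unstable stage [alpha] is recognised by a countable datum: a pair of
   tuples from the dense sequences and a rational separating stages [alpha] and
   [alpha + 1]; distinct stages have distinct data since the distances
   increase. *)
Lemma exists_stable A B : separable A -> separable B ->
  exists2 lambda, stable (Omega := Omega) A B lambda & ocountable lambda.
Proof.
move=> /separable_dense_seq[C dC] /separable_dense_seq[D dD].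
pose index : countType := {n : nat & n.-tuple nat * n.-tuple nat * rat}%type.
pose at_idx (s : index) alpha :=
  let: existT n (j, l, q) := s in
  bfle alpha (map_tuple C j) (map_tuple D l) (ratr q).
pose jump s alpha := at_idx s alpha /\ ~ at_idx s (osucc alpha).
have at_mono s alpha beta : ole alpha beta -> at_idx s beta -> at_idx s alpha.
  by case: s => n [[j l] q] /=; exact: bfle_mono.
have jump_uniq s alpha beta : jump s alpha -> jump s beta -> ole alpha beta.
  move=> [ha ha'] [hb hb']; have [//|h] := ole_or_olt alpha beta.
  by case: hb'; apply: at_mono ha; apply/ole_succ.
have unstable alpha : ~ stable (Omega := Omega) A B alpha -> exists s, jump s alpha.
  move=> /existsNP[n /existsNP[a /existsNP[b /existsNP[x /not_implyP[h h']]]]].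
  have [e /not_implyP[e0 he]] : exists e, ~ (0 < e -> bfle (osucc alpha) a b (x + e)).
    by apply/existsNP => H; apply: h'; exact: bfle_closed.
  (* Two fifths move [a] and [b] to dense tuples, one leaves room for the rational, and two move the
     tuples back. *)
  have e40 : 0 < e / 5 by rewrite divr_gt0.
  have [j hj] := dense_approx a dC e40; have [l hl] := dense_approx b dD e40.
  have : x + e / 5 + e / 5 < x + e / 5 + e / 5 + e / 5 by lra.
  move=> /(@rat_in_itvoo R)[q]; rewrite in_itv /= => /andP[q1 q2].
  exists (existT _ n (j, l, q)); split=> /=.
    apply: (bfle_le _ (bfle_move hj hl h)); lra.
  move=> H; apply: he.
  have sw A' (u v : n.-tuple A') : tuple_dist u v = tuple_dist v u.
    by apply/funext => i; exact: metric_sym.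
  rewrite sw in hj; rewrite sw in hl.
  apply: (bfle_le _ (bfle_move hj hl H)); lra.
have /choice[f hf] : forall s, exists alpha, forall beta, jump s beta -> oeq alpha beta.
  move=> s; have [[alpha ja]|/forallNP nj] := pselect (exists alpha, jump s alpha).
    by exists alpha => beta jb; split; [exact: jump_uniq ja jb|exact: jump_uniq jb ja].
  by exists ozero => beta /nj.
pose g k := if unpickle k is Some s then f s else ozero.
have gE s : g (pickle s) = f s by rewrite /g pickleK.
have [lambda st least] : exists2 lambda, stable (Omega := Omega) A B lambda &
    forall beta, stable (Omega := Omega) A B beta -> ole lambda beta.
  (* [osup g] is strictly above every unstable stage, so it is stable itself. *)
  apply: ord_least; exists (osup g); apply: contrapT => /unstable[s /hf [_ h]].
  by apply: olt_irr (ole_olt_trans h _); rewrite -(gE s); exact: olt_osup.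
exists lambda => //.
(* By minimality every stage below [lambda] is unstable, hence listed by [g]. *)
exists g => beta bl.
have /unstable[s js] : ~ stable (Omega := Omega) A B beta.
  by move=> /least /ole_olt_trans/(_ bl)/olt_irr.
by exists (pickle s); rewrite gE; exact: hf.
Qed.

Lemma scott_rank_exists A : separable A ->
  exists2 alpha, is_scott_rank Omega A alpha & ocountable alpha.
Proof.
move=> sA; have [lambda st cl] := exists_stable sA sA.
have [alpha sa least] : exists2 alpha, bf_stable Omega A alpha &
    forall beta, bf_stable Omega A beta -> ole alpha beta.
  by apply: ord_least; exists lambda; apply/bf_stableP.
exists alpha => //; apply: ocountable_ole cl; apply: least.
exact/bf_stableP.
Qed.

End ScottRank.

(** * Distances truncated to the unit interval *)

Section UnitIntervalFamilies.
Context {R : realType} {I : Type}.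
Variables (i0 : I) (f : I -> R).
Hypothesis f01 : forall i, 0 <= f i <= 1.

Lemma sup_family_leP x : sup (range f) <= x <-> forall i, f i <= x.
Proof.
have ub : has_ubound (range f) by exists 1 => _ [i _ <-]; case/andP: (f01 i).
split=> [h i|h]; first by apply: le_trans h; apply: ub_le_sup => //; exists i.
by apply: ge_sup; [exists (f i0), i0|move=> _ [i _ <-]].
Qed.

Lemma inf_family_leP x :
  inf (range f) <= x <-> forall e, 0 < e -> exists i, f i <= x + e.
Proof.
have lb : has_lbound (range f) by exists 0 => _ [i _ <-]; case/andP: (f01 i).
have hi : has_inf (range f) by split=> //; exists (f i0), i0.
split=> [h e e0|h].
  have [_ [i _ <-] /ltW fi] := inf_adherent e0 hi.
  by exists i; apply: le_trans fi _; rewrite lerD2r.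
apply/ler_addgt0Pr => e /h[i]; apply: le_trans.
by apply: ge_inf => //; exists i.
Qed.

Lemma sup_family01 : 0 <= sup (range f) <= 1.
Proof.
apply/andP; split; last by apply/sup_family_leP => i; case/andP: (f01 i).
have /andP[h _] := f01 i0; apply: le_trans h _.
exact: (sup_family_leP _).1 (lexx _) i0.
Qed.

Lemma inf_family01 : 0 <= inf (range f) <= 1.
Proof.
apply/andP; split.
  by apply: lb_le_inf; [exists (f i0), i0|move=> _ [i _ <-]; case/andP: (f01 i)].
apply/inf_family_leP => e e0; exists i0; have /andP[_ h] := f01 i0.
by apply: le_trans h _; rewrite lerDl ltW.
Qed.

End UnitIntervalFamilies.

Lemma le_iff_eq {R : realType} (u v : R) : (forall x, u <= x <-> v <= x) -> u = v.
Proof. by move=> h; apply/le_anti; rewrite (h v).2// (h u).1. Qed.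

Section TruncatedDistance.
Context {R : realType} {L : signature R} {Omega : (nat -> R) -> \bar R}.
Hypothesis wO : is_weak_modulus Omega.
Implicit Types (A B C : structure L).
Local Notation restr := (weak_modulus_restr Omega).
Local Notation bfle := (bfle (Omega := Omega)).
Local Notation basics := (@basic_formulas R L Omega).

(* [bf] may be infinite, whereas formulas have compact bounds. *)
Definition tdist A B alpha n (a : n.-tuple A) (b : n.-tuple B) : R :=
  fine (mine 1%E (bf Omega alpha a b)).

Lemma bf_ge0 A B alpha n (a : n.-tuple A) (b : n.-tuple B) : (0 <= bf Omega alpha a b)%E.
Proof.
have h x : bfle alpha a b x -> 0 <= x by exact: bfle_ge0.
rewrite /bfle in h; case: (bf Omega alpha a b) h => [r| |] h //.
  by rewrite lee_fin h.
by have := h (-1) (leNye _); rewrite ler0N1.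
Qed.

Lemma tdistE A B alpha n (a : n.-tuple A) (b : n.-tuple B) :
  (tdist alpha a b)%:E = mine 1%E (bf Omega alpha a b).
Proof.
rewrite fineK// fin_numElt; have := bf_ge0 alpha a b.
case: (bf Omega alpha a b) => [r| |]//=; rewrite /mine; last by case: ifP; rewrite ?ltNyr ?ltry.
by case: ifP; rewrite ?ltNyr ?ltry.
Qed.

Lemma tdist_leP A B alpha n (a : n.-tuple A) (b : n.-tuple B) x :
  tdist alpha a b <= x <-> 1 <= x \/ bfle alpha a b x.
Proof.
rewrite -[tdist _ _ _ <= _]lee_fin tdistE ge_min lee_fin.
by split=> [/orP|h]; [|apply/orP].
Qed.

Lemma tdist01 A B alpha n (a : n.-tuple A) (b : n.-tuple B) : 0 <= tdist alpha a b <= 1.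
Proof.
apply/andP; split; last by apply/tdist_leP; left.
by rewrite -lee_fin tdistE le_min lee01 bf_ge0.
Qed.

Lemma eq_tdist A B alpha beta n (a : n.-tuple A) (b : n.-tuple B) :
  bf Omega alpha a b = bf Omega beta a b -> tdist alpha a b = tdist beta a b.
Proof. by rewrite /tdist => ->. Qed.

Lemma tdist_oeq A B alpha beta n (a : n.-tuple A) (b : n.-tuple B) :
  oeq alpha beta -> tdist alpha a b = tdist beta a b.
Proof. by move=> /(bf_oeq Omega A B) e; apply: eq_tdist; rewrite e. Qed.

Lemma tdist_zeroP A B n (a : n.-tuple A) (b : n.-tuple B) x :
  tdist ozero a b <= x <-> forall phi, basics n phi ->
    Num.min 1 `|interp a phi - interp b phi| <= x.
Proof.
rewrite tdist_leP bfle_zero; split=> [[x1|h] phi bphi|h].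
- by rewrite ge_min x1.
- by rewrite ge_min h ?orbT.
- have [|x1] := leP 1 x; [by left|right => phi /h].
  by rewrite ge_min leNgt x1.
Qed.

Lemma tdist_succP A B alpha n (a : n.-tuple A) (b : n.-tuple B) x :
  tdist (osucc alpha) a b <= x <->
  (forall c e, 0 < e -> exists d, tdist alpha (rcons_tuple a c) (rcons_tuple b d) <= x + e) /\
  (forall d e, 0 < e -> exists c, tdist alpha (rcons_tuple a c) (rcons_tuple b d) <= x + e).
Proof.
rewrite tdist_leP bfle_succ; split=> [[x1|[hA hB]]|[hA hB]].
- have le1 e : 0 < e -> 1 <= x + e by move=> e0; lra.
  by split=> c e /le1 h; exists point; apply/tdist_leP; left.
- split=> [c e /(hA c)[d hd]|d e /(hB d)[c hc]].
    by exists d; apply/tdist_leP; right.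
  by exists c; apply/tdist_leP; right.
- have [|x1] := leP 1 x; [by left|right].
  (* When [x < 1] the error is shrunk until [x + e' < 1], where the truncation has no effect. *)
  have small e : 0 < e -> exists2 e', 0 < e' & (x + e' < 1 /\ x + e' <= x + e).
    move=> e0; exists (Num.min e ((1 - x) / 2)); first by rewrite lt_min e0 divr_gt0// subr_gt0.
    have m1 : Num.min e ((1 - x) / 2) <= e by rewrite ge_min lexx.
    have m2 : Num.min e ((1 - x) / 2) <= (1 - x) / 2 by rewrite ge_min lexx orbT.
    by split; lra.
  have key A' B' (u : n.+1.-tuple A') (v : n.+1.-tuple B') y z :
      y < 1 -> y <= z -> tdist alpha u v <= y -> bfle alpha u v z.
    move=> y1 yz /tdist_leP[|]; [by rewrite leNgt y1|exact: bfle_le].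
  split=> [c e|d e] /small[e' e0' [xe ee]].
    by have [d hd] := hA c e' e0'; exists d; exact: key hd.
  by have [c hc] := hB d e' e0'; exists c; exact: key hc.
Qed.

Lemma tdist_limitP A B alpha n (a : n.-tuple A) (b : n.-tuple B) x : olimit alpha ->
  tdist alpha a b <= x <-> forall beta, olt beta alpha -> tdist beta a b <= x.
Proof.
move=> la; rewrite tdist_leP (bfle_limit _ _ _ la); split=> [[x1|h] beta ba|h].
- by apply/tdist_leP; left.
- by apply/tdist_leP; right; exact: h.
- have [|x1] := leP 1 x; [by left|right => beta /h/tdist_leP[]//].
  by rewrite leNgt x1.
Qed.

Lemma tdist_mono A B alpha beta n (a : n.-tuple A) (b : n.-tuple B) :
  ole alpha beta -> tdist alpha a b <= tdist beta a b.
Proof.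
move=> ab; apply/tdist_leP; have [|h] := (tdist_leP _ _ _ _).1 (lexx (tdist beta a b)).
  by left.
by right; exact: bfle_mono h.
Qed.

Lemma tdist_triangle A B C alpha n (a : n.-tuple A) (b : n.-tuple B) (c : n.-tuple C) :
  tdist alpha a c <= tdist alpha a b + tdist alpha b c.
Proof.
have := tdist01 alpha a b; have := tdist01 alpha b c => /andP[h1 _] /andP[h2 _].
apply/tdist_leP.
have [|h] := (tdist_leP _ _ _ _).1 (lexx (tdist alpha a b)); first by left; lra.
have [|h'] := (tdist_leP _ _ _ _).1 (lexx (tdist alpha b c)); first by left; lra.
by right; exact: bfle_triangle h h'.
Qed.

Lemma tdist_sym A B alpha n (a : n.-tuple A) (b : n.-tuple B) :
  tdist alpha a b = tdist alpha b a.
Proof.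
by apply: le_iff_eq => x; split=> /tdist_leP[h|/bfle_sym h]; apply/tdist_leP;
  [left|right|left|right].
Qed.

Lemma tdist_self A alpha n (a a' : n.-tuple A) x :
  (restr n (tuple_dist a a') <= x%:E)%E -> tdist alpha a a' <= x.
Proof. by move=> h; apply/tdist_leP; right; exact: bfle_self. Qed.

Lemma tdist_move A B alpha n (a a' : n.-tuple A) (b b' : n.-tuple B) u v :
  (restr n (tuple_dist a a') <= u%:E)%E -> (restr n (tuple_dist b b') <= v%:E)%E ->
  tdist alpha a' b' <= u + tdist alpha a b + v.
Proof.
move=> /(tdist_self alpha) ha /(tdist_self alpha) hb.
apply: le_trans (tdist_triangle alpha a' b b') _; apply: lerD => //.
apply: le_trans (tdist_triangle alpha a' a b) _.
by rewrite lerD2r tdist_sym.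
Qed.

(** The radius depends on [n] and [e] only, so one choice serves the tuples of every structure. *)
Lemma rcons_near n (e : R) : 0 < e -> exists2 d : R, 0 < d &
  forall A (a : n.-tuple A) c c', mdist c c' < d ->
    (restr n.+1 (tuple_dist (rcons_tuple a c) (rcons_tuple a c')) <= e%:E)%E.
Proof.
move=> e0; have [d d0 h] := restr_small wO n.+1 e0.
exists d => // A a c c' cc; apply: h; first exact: tuple_dist_orthant.
move=> i ni; rewrite /tuple_dist !nth_rcons_tuple.
by case: ifP => _; [rewrite mdistxx|case: ifP; rewrite ?mdistxx].
Qed.

(** Moving the last entry slightly changes the distance at stage [alpha] only slightly, so moves and
    answers may be restricted to dense families on both sides. *)
Lemma tdist_succE A B alpha n (a : n.-tuple A) (b : n.-tuple B)
    (I J : Type) (C : I -> A) (D : J -> B) : dense_seq C -> dense_seq D ->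
  tdist (osucc alpha) a b = Num.max
    (sup (range (fun k => inf (range (fun i =>
       tdist alpha (rcons_tuple a (C k)) (rcons_tuple b (D i)))))))
    (sup (range (fun i => inf (range (fun k =>
       tdist alpha (rcons_tuple a (C k)) (rcons_tuple b (D i))))))).
Proof.
move=> dC dD.
have [k0 _] := dC point 1 ltr01; have [i0 _] := dD point 1 ltr01.
pose t k i := tdist alpha (rcons_tuple a (C k)) (rcons_tuple b (D i)).
have t01 k i : 0 <= t k i <= 1 by exact: tdist01.
apply: le_iff_eq => x; rewrite tdist_succP ge_max.
split=> [[hA hB]|/andP[]].
  apply/andP; split.
    apply/(sup_family_leP k0 (fun k => inf_family01 i0 (t01 k))) => k.
    (* One third for the answer and one for each tuple in [tdist_move], including the tuple that
       stays in place. *)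
    apply/(inf_family_leP i0 (t01 k)) => e e0; have e30 : 0 < e / 3 by rewrite divr_gt0.
    have [d hd] := hA (C k) _ e30; have [d0 d00 near] := rcons_near n e30.
    have [i di] := dD d _ d00; exists i.
    have nC := near _ a (C k) (C k); rewrite mdistxx in nC.
    by have := tdist_move alpha (nC d00) (near _ b _ _ di); rewrite /t; lra.
  apply/(sup_family_leP i0 (fun i => inf_family01 k0 (t01^~ i))) => k.
  apply/(inf_family_leP k0 (t01^~ k)) => e e0; have e30 : 0 < e / 3 by rewrite divr_gt0.
  have [d hd] := hB (D k) _ e30; have [d0 d00 near] := rcons_near n e30.
  have [i di] := dC d _ d00; exists i.
  have nC := near _ b (D k) (D k); rewrite mdistxx in nC.
  by have := tdist_move alpha (near _ a _ _ di) (nC d00); rewrite /t; lra.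
move=> /(sup_family_leP k0 (fun k => inf_family01 i0 (t01 k))) hA.
move=> /(sup_family_leP i0 (fun i => inf_family01 k0 (t01^~ i))) hB.
split=> [c e e0|d e e0]; have e30 : 0 < e / 3 by rewrite divr_gt0.
  have [d0 d00 near] := rcons_near n e30; have [k ck] := dC c _ d00.
  have /(inf_family_leP i0 (t01 k))/(_ _ e30)[i hi] := hA k.
  exists (D i); have nD := near _ b (D i) (D i); rewrite mdistxx in nD.
  rewrite metric_sym in ck.
  by have := tdist_move alpha (near _ a _ _ ck) (nD d00); rewrite /t in hi; lra.
have [d0 d00 near] := rcons_near n e30; have [i di] := dD d _ d00.
have /(inf_family_leP k0 (t01^~ i))/(_ _ e30)[k hk] := hB i.
exists (C k); have nC := near _ a (C k) (C k); rewrite mdistxx in nC.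
rewrite metric_sym in di.
by have := tdist_move alpha (nC d00) (near _ b _ _ di); rewrite /t in hk; lra.
Qed.

Lemma tdist_limitE A B alpha n (a : n.-tuple A) (b : n.-tuple B) (f : nat -> Ord) :
  olimit alpha -> (forall k, olt (f k) alpha) ->
  (forall beta, olt beta alpha -> exists k, ole beta (f k)) ->
  tdist alpha a b = sup (range (fun k => tdist (f k) a b)).
Proof.
move=> la fa cof; apply: le_iff_eq => x; rewrite tdist_limitP//.
rewrite (sup_family_leP 0%N (fun k => tdist01 (f k) a b)); split=> h.
  by move=> k; exact: h.
move=> beta /cof[k bk]; exact: le_trans (tdist_mono _ _ bk) (h k).
Qed.

(** Every ordinal below [alpha] is listed, not merely a cofinal set; entries of the given
    enumeration that are not below [alpha] are replaced by [ozero]. *)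
Lemma countable_limit alpha : olimit alpha -> ocountable alpha -> exists f : nat -> Ord,
  (forall k, olt (f k) alpha) /\ (forall beta, olt beta alpha -> exists k, oeq (f k) beta).
Proof.
move=> la [f hf]; have a0 : olt ozero alpha.
  have [h|//] := ole_or_olt alpha ozero.
  by case: la => -[]; split=> //; exact: ole_zero.
exists (fun k => if pselect (olt (f k) alpha) is left _ then f k else ozero); split.
  by move=> k; case: pselect.
move=> beta ba; have [k fk] := hf beta ba; exists k.
by case: pselect => // -[]; exact: ole_olt_trans fk.1 ba.
Qed.

End TruncatedDistance.

(** * A countable family of basic formulas *)

Section Countability.
Context {R : realType} {L : signature R}.
Hypothesis cL : countable_signature L.

(** Finitely branching trees labelled by numbers form a countable type, from which terms inherit
    countability. *)
Fixpoint term_code (fcode : fsym L -> nat) (t : term L) : GenTree.tree nat :=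
  match t with
  | Var i => GenTree.Leaf i
  | App F tau => GenTree.Node (fcode F)
      [seq term_code fcode (tau k) | k <- enum 'I_(farity F)]
  end.

Lemma eq_map_enum (n : nat) (T : Type) (f g : 'I_n -> T) :
  [seq f k | k <- enum 'I_n] = [seq g k | k <- enum 'I_n] -> f =1 g.
Proof.
move=> fg k; have ke : k \in enum 'I_n by rewrite mem_enum.
elim: (enum 'I_n) ke fg => // j s IH; rewrite in_cons => /orP[/eqP<-|ks] [] //.
by move=> _; exact: IH.
Qed.

Lemma term_code_inj fcode : injective fcode -> injective (term_code fcode).
Proof.
move=> fi; elim=> [i|F tau IH] [j|G sigma] //= []; first by move=> ->.
move=> /fi FG; subst G => /eq_map_enum h; congr App.
by apply/funext => k; apply/IH/h.
Qed.

Lemma countable_type_inj (T : Type) : countable [set: T] -> exists f : T -> nat, injective f.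
Proof.
move=> /countable_injP[f injf]; exists f => x y fxy.
by apply: injf => //; exact/mem_set.
Qed.

Lemma atoms_enumeration : exists e : nat -> formula L,
  forall (P : pred_symbol L) (tau : 'I_(parity P) -> term L), exists k, e k = Atom tau.
Proof.
have [/countable_type_inj[fcode fi] /countable_type_inj[pcode pi]] := cL.
pose pscode (P : pred_symbol L) := if P is Pred Q then (pcode Q).+1 else 0%N.
have psi : injective pscode by move=> [|P] [|Q] //= [] /pi ->.
pose acode (P : pred_symbol L) (tau : 'I_(parity P) -> term L) :=
  GenTree.Node (pscode P) [seq term_code fcode (tau k) | k <- enum 'I_(parity P)].
have acode_inj P tau Q sigma : @acode P tau = @acode Q sigma -> Atom tau = Atom sigma.
  move=> [] /psi PQ; subst Q => /eq_map_enum h; congr Atom.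
  by apply/funext => k; apply: (term_code_inj fi); exact: h.
have /choice[e he] : forall k : nat, exists phi, forall P tau,
    pickle (@acode P tau) = k -> phi = Atom tau.
  move=> k; have [[P [tau Pk]]|none] := pselect (exists P tau, pickle (@acode P tau) = k).
    exists (Atom tau) => Q sigma Qk; apply: acode_inj.
    by apply: (pcan_inj pickleK); rewrite Pk Qk.
  exists (@Atom R L (Dist L) (fun=> Var L 0)) => P tau Pk.
  by case: none; exists P, tau.
by exists e => P tau; exists (pickle (acode P tau)); exact: he.
Qed.

End Countability.

Section CountableBasics.
Context {R : realType} {L : signature R} {Omega : (nat -> R) -> \bar R}.
Hypothesis wO : is_weak_modulus Omega.
Hypothesis cL : countable_signature L.
Implicit Types (A B C : structure L).
Local Notation basics := (@basic_formulas R L Omega).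
Local Notation tdist := (tdist (Omega := Omega)).

(** A finite list of constraints, each naming a coordinate and one rational interval for either
    sequence; such lists form a countable type. *)
Definition rat_box := seq (nat * (rat * rat) * (rat * rat)).

Definition in_rat_box (s : rat_box) (u v : nat -> R) : Prop :=
  forall k p q, (k, p, q) \in s ->
    ratr p.1 < u k < ratr p.2 /\ ratr q.1 < v k < ratr q.2.

Lemma rat_box_near (m : nat) (kappa : 'I_m -> nat) (u v : nat -> R) (d : R) : 0 < d ->
  exists2 s : rat_box, in_rat_box s u v & forall u' v', in_rat_box s u' v' ->
    forall i, `|u (kappa i) - u' (kappa i)| < d /\ `|v (kappa i) - v' (kappa i)| < d.
Proof.
move=> d0.
have enc (x : R) : exists p : rat * rat, ratr p.1 < x < ratr p.2 /\
    forall y, ratr p.1 < y < ratr p.2 -> `|x - y| < d.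
  have /(@rat_in_itvoo R)[p] : x - d < x by lra.
  have /(@rat_in_itvoo R)[q] : x < x + d by lra.
  rewrite !in_itv /= => /andP[q1 q2] /andP[p1 p2].
  exists (p, q); split=> /= [|y /andP[py yq]]; first by rewrite p2.
  by rewrite ltr_norml; apply/andP; split; lra.
have /choice[pu hu] i := enc (u (kappa i)).
have /choice[pv hv] i := enc (v (kappa i)).
exists [seq (kappa i, pu i, pv i) | i <- enum 'I_m].
  by move=> k p q /mapP[i _ [-> -> ->]]; split; [have [] := hu i|have [] := hv i].
move=> u' v' h i; have [h1 h2] := h (kappa i) (pu i) (pv i) (map_f _ (mem_enum _ i)).
by split; [have [_] := hu i; exact|have [_] := hv i; exact].
Qed.

(* Hereditary Lindelof argument: for a rational box of pairs of atomic values
   and a rational [r], pick one basic formula, if any, whose two values differ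
   by more than [r] throughout the box. *)
Lemma countable_basics n : exists phi : nat -> formula L,
  (forall k, basics n (phi k)) /\
  forall A B (a : n.-tuple A) (b : n.-tuple B),
    tdist ozero a b = sup (range (fun k => Num.min 1 `|interp a (phi k) - interp b (phi k)|)).
Proof.
have [e he] := atoms_enumeration cL.
pose atoms A (a : n.-tuple A) k := interp a (e k).
pose gap phi A B (a : n.-tuple A) (b : n.-tuple B) := `|interp a phi - interp b phi|.
(* All pairs of structures are treated at once, so that the selected formulas depend on [n] only. *)
pose large (s : rat_box * rat) phi := basics n phi /\
  forall A B (a : n.-tuple A) (b : n.-tuple B),
    in_rat_box s.1 (atoms A a) (atoms B b) -> ratr s.2 < gap phi A B a b.
have [phi0 bphi0] := basics_nonempty (L := L) wO n.
have /choice[Phi hPhi] : forall s, exists phi, basics n phi /\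
    ((exists psi, large s psi) -> large s phi).
  move=> s; have [[psi ls]|none] := pselect (exists psi, large s psi).
    by exists psi; split=> //; case: ls.
  by exists phi0.
pose phi k := if unpickle k is Some s then Phi s else phi0.
have bphi k : basics n (phi k).
  by rewrite /phi; case: unpickle => [s|//]; have [] := hPhi s.
exists phi; split=> // A B a b; apply: le_iff_eq => x.
have gap01 k : 0 <= Num.min 1 `|interp a (phi k) - interp b (phi k)| <= 1.
  by rewrite le_min ler01 normr_ge0 ge_min lexx.
rewrite tdist_zeroP// (sup_family_leP 0%N gap01).
split=> [h k|h psi bpsi]; first exact/h/bphi.
rewrite leNgt; apply/negP; rewrite lt_min => /andP[x1 xgap].
have /(@rat_in_itvoo R)[r] := xgap; rewrite in_itv /= => /andP[xr rgap].
suff [s [sab ls]] : exists s, in_rat_box s (atoms A a) (atoms B b) /\ large (s, r) psi.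
  have [_ [|_ /(_ A B a b sab)]] := hPhi (s, r); first by exists psi.
  move=> /= rPhi; have := h (pickle (s, r)); rewrite /phi pickleK leNgt lt_min x1 /=.
  by move=> /negP; apply; exact: lt_trans xr rPhi.
have [[m [f [P [tau psiE]]]] wpsi _ _] := bpsi.
have cf : {within box (fun i => Atom (@tau i)), continuous (f : {ptws 'I_m -> R} -> R)}.
  by move: wpsi; rewrite psiE => -[].
have /choice[kappa hk] i := he (P i) (@tau i).
have psiA A' (a' : n.-tuple A') : interp a' psi = f (fun i => atoms A' a' (kappa i)).
  by rewrite psiE; congr f; apply/funext => i; rewrite /atoms hk.
have boxA A' (a' : n.-tuple A') : box (fun i => Atom (@tau i)) (fun i => atoms A' a' (kappa i)).
  by move=> i; rewrite /atoms hk; exact: pint_bound.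
(* Each of the two perturbations loses less than half of the margin above [r]. *)
pose eps := (gap psi A B a b - ratr r) / 2.
have eps0 : 0 < eps by rewrite divr_gt0// subr_gt0.
have [d1 d10 h1] := within_ptws_eps cf (boxA A a) eps0.
have [d2 d20 h2] := within_ptws_eps cf (boxA B b) eps0.
have d0 : 0 < Num.min d1 d2 by rewrite lt_min d10.
have [s sab hs] := rat_box_near kappa (atoms A a) (atoms B b) d0.
exists s; split=> //; split=> // A' B' a' b' /hs near.
have ha : `|interp a psi - interp a' psi| < eps.
  rewrite !psiA; apply: h1 => // i; have [+ _] := near i.
  by rewrite lt_min => /andP[].
have hb : `|interp b psi - interp b' psi| < eps.
  rewrite !psiA; apply: h2 => // i; have [_] := near i.
  by rewrite lt_min => /andP[].
have : gap psi A B a b <= `|interp a psi - interp a' psi| +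
    (gap psi A' B' a' b' + `|interp b psi - interp b' psi|).
  rewrite /gap (distrC (interp b psi)).
  by rewrite (le_trans (ler_distD (interp a' psi) _ _))// lerD2l ler_distD.
by move: ha hb; rewrite /eps /gap /=; lra.
Qed.

End CountableBasics.

(** * Scott sentences *)

Section UnitFormulas.
Context {R : realType} {L : signature R}.
Implicit Types (Delta : (nat -> R) -> R) (phi psi : formula L).

(** [Delta] merely dominates the modulus, so that countably many formulas can share it, as [Vee] and
    [Wedge] require. *)
Definition unit_formula n Delta phi : Prop :=
  [/\ well_formed phi, fv phi `<=` [set i | (i < n)%N],
      forall delta, orthant delta -> modulus phi delta <= Delta delta
    & bound phi `<=` `[0, 1] ].

Lemma unit_formula_le n Delta Delta' phi :
  (forall delta, orthant delta -> Delta delta <= Delta' delta) ->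
  unit_formula n Delta phi -> unit_formula n Delta' phi.
Proof.
by move=> DD [w f m b]; split=> // x x0; exact: le_trans (m x x0) (DD x x0).
Qed.

Lemma respects_common_unit n Delta (phi : nat -> formula L) : is_modulus Delta ->
  (forall k, unit_formula n Delta (phi k)) -> respects_common Delta 0 1 phi.
Proof. by move=> mD u; split=> // k; have [] := u k. Qed.

Lemma unit_Vee n Delta (phi : nat -> formula L) : is_modulus Delta ->
  (forall k, unit_formula n Delta (phi k)) -> unit_formula n Delta (Vee Delta 0 1 phi).
Proof.
move=> mD u; split=> //=.
- split=> [k|]; [by have [] := u k|exact: respects_common_unit u].
- by move=> i [k _]; have [_ + _ _] := u k; apply.
Qed.

Lemma unit_Wedge n Delta (phi : nat -> formula L) : is_modulus Delta ->
  (forall k, unit_formula n Delta (phi k)) -> unit_formula n Delta (Wedge Delta 0 1 phi).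
Proof.
move=> mD u; split=> //=.
- split=> [k|]; [by have [] := u k|exact: respects_common_unit u].
- by move=> i [k _]; have [_ + _ _] := u k; apply.
Qed.

Lemma orthant_set0 (delta : nat -> R) i : orthant delta -> orthant [eta delta with i |-> 0].
Proof. by move=> d0 j /=; case: ifP. Qed.

Lemma unit_QSup n Delta phi : unit_formula n.+1 Delta phi ->
  unit_formula n (fun delta => Delta [eta delta with n |-> 0]) (QSup n phi).
Proof.
move=> [w f m b]; split=> //= [i [/f /= + /eqP]|x x0]; last first.
  by apply: m; exact: orthant_set0.
by rewrite ltnS leq_eqVlt => /orP[->|].
Qed.

Lemma unit_QInf n Delta phi : unit_formula n.+1 Delta phi ->
  unit_formula n (fun delta => Delta [eta delta with n |-> 0]) (QInf n phi).
Proof. by move=> /unit_QSup. Qed.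

Lemma ler_dist_min1 (u v : R) : `|Num.min 1 u - Num.min 1 v| <= `|u - v|.
Proof.
case: (leP 1 u) => ?; case: (leP 1 v) => ?; case: (ger0P (u - v)) => ?;
by rewrite ?ler_norml ?lexx //; apply/andP; split; lra.
Qed.

Lemma ler_dist_max0 (u v : R) : `|Num.max 0 u - Num.max 0 v| <= `|u - v|.
Proof.
case: (leP 0 u) => ?; case: (leP 0 v) => ?; case: (ger0P (u - v)) => ?;
by rewrite ?ler_norml ?lexx //; apply/andP; split; lra.
Qed.

Definition dist_to (r : R) (x : 'I_1 -> R) : R := Num.min 1 `|x ord0 - r|.

Lemma dist_to_lip r (x y : 'I_1 -> R) : `|dist_to r x - dist_to r y| <= `|x ord0 - y ord0|.
Proof.
apply: le_trans (ler_dist_min1 _ _) _; apply: le_trans (ler_dist_dist _ _) _.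
by rewrite opprB addrA subrK.
Qed.

(** Values of [dist_to] differ by at most 1, so [Delta] has to dominate the modulus of [phi] only up
    to 1; this admits [trunc_modulus]. *)
Lemma unit_dist_to n Delta phi r : well_formed phi -> fv phi `<=` [set i | (i < n)%N] ->
  (forall delta, orthant delta -> 0 <= Delta delta) ->
  (forall delta c, orthant delta -> 0 <= c -> c <= 1 ->
    c <= modulus phi delta -> c <= Delta delta) ->
  unit_formula n Delta (Conn (dist_to r) (fun=> phi)).
Proof.
move=> w f D0 m; split=> /=.
- split=> //; apply: ptws_eps_within => x _ e e0; exists e => //.
  by exists [:: ord0] => y _ h; apply: le_lt_trans (dist_to_lip r x y) (h _ (mem_head _ _)).
- by move=> i [k _]; exact: f.
- move=> x x0; apply: conn_modulus_le; first exact: D0.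
  move=> y z _ _ yz; apply: m => //; last exact: le_trans (dist_to_lip r y z) (yz _).
  rewrite /dist_to; have h (a : R) : 0 <= a -> 0 <= Num.min 1 a <= 1.
    by move=> a0; rewrite le_min ler01 a0 ge_min lexx.
  have /andP[h1 h2] := h `|y ord0 - r| (normr_ge0 _).
  have /andP[h3 h4] := h `|z ord0 - r| (normr_ge0 _).
  by rewrite ler_norml; apply/andP; split; lra.
- move=> _ [x _ <-]; rewrite /= in_itv /= /dist_to.
  by rewrite le_min ler01 normr_ge0 ge_min lexx.
Qed.

Definition tsub (x : 'I_2 -> R) : R := Num.max 0 (x ord0 - x ord_max).

Lemma tsub_lip (x y : 'I_2 -> R) :
  `|tsub x - tsub y| <= `|x ord0 - y ord0| + `|x ord_max - y ord_max|.
Proof.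
apply: le_trans (ler_dist_max0 _ _) _.
have -> : x ord0 - x ord_max - (y ord0 - y ord_max) =
  (x ord0 - y ord0) - (x ord_max - y ord_max) by lra.
exact: ler_normB.
Qed.

Definition pair_family phi psi (i : 'I_2) : formula L := if i == ord0 then phi else psi.

(** A difference can vary twice as much as its terms. The doubling does no harm once all variables
    are bound, since the modulus is then evaluated at 0. *)
Lemma unit_tsub n Delta phi psi : (forall delta, orthant delta -> 0 <= Delta delta) ->
  unit_formula n Delta phi -> unit_formula n Delta psi ->
  unit_formula n (fun delta => Delta delta + Delta delta) (Conn tsub (pair_family phi psi)).
Proof.
move=> D0 [w f m b] [w' f' m' b'].
have wd (Q : formula L -> Prop) : Q phi -> Q psi -> forall i, Q (pair_family phi psi i).
  by move=> q1 q2 i; rewrite /pair_family; case: ifP.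
split=> /=.
- split; first exact: wd.
  apply: ptws_eps_within => x _ e e0; exists (e / 2); first by rewrite divr_gt0.
  exists [:: ord0; ord_max] => y _ h; apply: le_lt_trans (tsub_lip x y) _.
  by rewrite (splitr e) ltrD// h.
- by move=> i [k _]; exact: (wd (fun c => fv c i -> (i < n)%N) (f i) (f' i)).
- move=> x x0; apply: conn_modulus_le; first by rewrite addr_ge0 ?D0.
  move=> y z _ _ yz; apply: le_trans (tsub_lip y z) _; apply: lerD.
    exact: le_trans (yz ord0) (m x x0).
  exact: le_trans (yz ord_max) (m' x x0).
- move=> _ [x hx <-]; have [h0 h1] := (b _ (hx ord0), b' _ (hx ord_max)).
  move: h0 h1; rewrite /= !in_itv /= /tsub => /andP[? ?] /andP[? ?].
  by rewrite le_max lexx ge_max ler01 /=; lra.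
Qed.

End UnitFormulas.

Lemma eq_sup_range {R : realType} (I : Type) (f g : I -> R) :
  f =1 g -> sup (range f) = sup (range g).
Proof. by move=> /funext ->. Qed.

Lemma eq_inf_range {R : realType} (I : Type) (f g : I -> R) :
  f =1 g -> inf (range f) = inf (range g).
Proof. by move=> /funext ->. Qed.

Section ScottFormulas.
Context {R : realType} {L : signature R} {Omega : (nat -> R) -> \bar R}.
Hypothesis wO : is_weak_modulus Omega.
Hypothesis cL : countable_signature L.
Implicit Types (A B C : structure L).
Local Notation tdist := (tdist (Omega := Omega)).
Local Notation tm := (trunc_modulus Omega).

Lemma trunc_modulus_ge0 n (delta : nat -> R) : orthant delta -> 0 <= tm n delta.
Proof. exact: (modulus_ge0 (trunc_modulusP wO n)). Qed.

Lemma trunc_modulus_set0 n (delta : nat -> R) : tm n.+1 [eta delta with n |-> 0] = tm n delta.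
Proof.
rewrite /trunc_modulus restrS_0 /= ?eqxx// (@restr_ext _ _ _ _ delta)// => i.
by rewrite /= ltn_neqAle => /andP[/negbTE ->].
Qed.

(** The tuple [a] is a parameter built into [phi]; the free variables stand for a tuple of [B], and
    the same formula serves every [B]. *)
Definition defines A alpha n (a : n.-tuple A) (phi : formula L) : Prop :=
  [/\ unit_formula n (tm n) phi, oeq (qr phi) alpha
    & forall B (v : nat -> B), eval v phi = tdist alpha a (prefix_tuple n v)].

(** The values at [a] of countably many basic formulas become real constants inside the connectives
    [dist_to]. *)
Lemma defines_zero A n (a : n.-tuple A) : exists phi, defines ozero a phi.
Proof.
have [phi [bphi phiE]] := countable_basics wO cL n.
exists (Vee (tm n) 0 1 (fun k => Conn (dist_to (interp a (phi k))) (fun=> phi k))).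
split.
- apply: unit_Vee; first exact: trunc_modulusP.
  move=> k; have [_ wk fk mk] := bphi k; apply: unit_dist_to => //.
    by move=> x x0; exact: trunc_modulus_ge0.
  move=> x c x0 c0 c1 cm; apply: (le_trunc_modulus wO) => //.
  by apply: le_trans (mk x x0); rewrite lee_fin.
- split; last exact: ole_zero.
  apply/olub_ole => k /=; apply/bigomaxP => _.
  have [[m [f [P [tau ->]]]] _ _ _] := bphi k.
  by apply/bigomaxP => i; exact: ole_refl.
- move=> B v; rewrite phiE /=; congr sup.
  apply/seteqP; split=> z [k _ <-]; exists k => //;
    rewrite /dist_to distrC; congr (Num.min _ `|_ - _|).
    have [[m [f [P [tau ->]]]] _ fk _] := bphi k.
    by apply: basic_eval_ext => i /fk ni; rewrite nth_prefix_tuple.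
  have [[m [f [P [tau ->]]]] _ fk _] := bphi k.
  by apply: basic_eval_ext => i /fk ni; rewrite nth_prefix_tuple.
Qed.

(** The maximum, written as a countable disjunction that repeats [psi]: this keeps the modulus and
    the bound unchanged. *)
Definition or_formula n (phi psi : formula L) : formula L :=
  Vee (tm n) 0 1 (fun k => if k is 0 then phi else psi).

Lemma sup_or (u v : R) : sup (range (fun k : nat => if k is 0 then u else v)) = Num.max u v.
Proof.
apply: le_iff_eq => x; rewrite ge_max; split=> [h|/andP[ux vx]].
  have ub : has_ubound (range (fun k : nat => if k is 0 then u else v)).
    by exists (Num.max u v) => _ [[|k] _ <-]; rewrite le_max lexx ?orbT.
  by apply/andP; split; apply: le_trans h; apply: ub_le_sup => //; [exists 0%N|exists 1%N].
by apply: ge_sup; [exists u, 0%N|move=> _ [[|k] _ <-]].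
Qed.

Lemma unit_or n phi psi : unit_formula n (tm n) phi -> unit_formula n (tm n) psi ->
  unit_formula n (tm n) (or_formula n phi psi).
Proof. by move=> u v; apply: unit_Vee => [|[|k]] //; exact: trunc_modulusP. Qed.

(** Moves in [A] run over the dense sequence and become countable disjunctions or conjunctions,
    which cost no rank. Moves in [B] become quantifiers, since the formula has to serve every [B];
    each half contains one. *)
Lemma defines_succ A (C : nat -> A) alpha n (a : n.-tuple A) : dense_seq C ->
  (forall k, exists phi, defines alpha (rcons_tuple a (C k)) phi) ->
  exists phi, defines (osucc alpha) a phi.
Proof.
move=> dC /choice[phi hphi].
have tmP m : is_modulus (tm m) by exact: trunc_modulusP.
have utm (chi : formula L) : unit_formula n (fun x => tm n.+1 [eta x with n |-> 0]) chi ->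
    unit_formula n (tm n) chi.
  by apply: unit_formula_le => x _; rewrite trunc_modulus_set0.
exists (or_formula n (Vee (tm n) 0 1 (fun k => QInf n (phi k)))
  (QSup n (Wedge (tm n.+1) 0 1 phi))); split.
- apply: unit_or.
    by apply: unit_Vee => // k; apply: utm; apply: unit_QInf; have [] := hphi k.
  apply: utm; apply: unit_QSup; apply: unit_Wedge => // k; by have [] := hphi k.
- have qk k : oeq (qr (phi k)) alpha by have [] := hphi k.
  split.
    apply/olub_ole => -[|k]; first by apply/olub_ole => k; apply/ole_succ2; exact: (qk k).1.
    by apply/ole_succ2/olub_ole => j; exact: (qk j).1.
  apply: ole_trans (ole_olub _ 1%N); apply/ole_succ2.
  apply: ole_trans (qk 0%N).2 _; exact: (ole_olub (fun k => qr (phi k)) 0%N).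
- move=> B v; rewrite /= (_ : (fun k => _) = fun k => if k is 0 then
      eval v (Vee (tm n) 0 1 (fun k => QInf n (phi k))) else
      eval v (QSup n (Wedge (tm n.+1) 0 1 phi))); last first.
    by apply/funext => -[].
  (* The quantifiers range over all of [B], hence the identity as its dense family. *)
  rewrite sup_or (tdist_succE wO alpha a (prefix_tuple n v) (D := @id B) dC); last first.
    by move=> x e e0; exists x; rewrite mdistxx.
  have ev k c : eval [eta v with n |-> c] (phi k) =
      tdist alpha (rcons_tuple a (C k)) (rcons_tuple (prefix_tuple n v) c).
    by have [_ _ ->] := hphi k; rewrite rcons_prefix_tuple.
  congr (Num.max _ _); apply: eq_sup_range => k; apply: eq_inf_range => c; exact: ev.
Qed.

Lemma defines_limit A alpha n (a : n.-tuple A) : olimit alpha -> ocountable alpha ->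
  (forall beta, olt beta alpha -> exists phi, defines beta a phi) ->
  exists phi, defines alpha a phi.
Proof.
move=> la ca h; have [f [fa cof]] := countable_limit la ca.
have /choice[phi hphi] k := h _ (fa k).
exists (Vee (tm n) 0 1 phi); split.
- by apply: unit_Vee => [|k]; [exact: trunc_modulusP|have [] := hphi k].
- have qk k : oeq (qr (phi k)) (f k) by have [] := hphi k.
  split.
    by apply/olub_ole => k; apply: ole_trans (qk k).1 (oltW (fa k)).
  (* Were the rank below the limit [alpha], its successor would be too, and would then be the rank
     of a disjunct. *)
  have [//|lt] := ole_or_olt alpha (qr (Vee (tm n) 0 1 phi)).
  have [k fk] := cof _ (olt_limit_succ la lt).
  case: (@olt_irr (qr (Vee (tm n) 0 1 phi))); apply/ole_succ.
  apply: ole_trans fk.2 _; apply: ole_trans (qk k).2 _.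
  exact: (ole_olub (fun k => qr (phi k)) k).
- move=> B v /=; rewrite (tdist_limitE wO a (prefix_tuple n v) la fa); last first.
    by move=> beta /cof[k [_ fk]]; exists k.
  by apply: eq_sup_range => k; have [_ _ ->] := hphi k.
Qed.

Lemma defines_exists A alpha : separable A -> ocountable alpha ->
  forall n (a : n.-tuple A), exists phi, defines alpha a phi.
Proof.
move=> /separable_dense_seq[C dC].
elim/ord_ind3: alpha => [alpha beta ab IH||alpha IH|alpha la IH] ca n.
- move=> a; have [|phi [u q e]] := IH _ n a; first by apply: ocountable_ole ca; case: ab.
  exists phi; split=> //; first exact: oeq_trans q ab.
  by move=> B v; rewrite e; exact: tdist_oeq.
- exact: defines_zero.
- move=> a; apply: defines_succ dC _ => k; apply: IH.
  exact: ocountable_ole (oltW (olt_succ _)) ca.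
- move=> a; apply: defines_limit => // beta ba; apply: IH => //.
  exact: ocountable_ole (oltW ba) ca.
Qed.

End ScottFormulas.

(** * Distance zero decided at the Scott rank *)

Section ScottCriterion.
Context {R : realType} {L : signature R} {Omega : (nat -> R) -> \bar R}.
Hypothesis wO : is_weak_modulus Omega.
Implicit Types (A B C : structure L).
Local Notation tdist := (tdist (Omega := Omega)).
Local Notation bfle := (bfle (Omega := Omega)).

Lemma bf_infty0P A B : bf_infty Omega (nil_tuple A) (nil_tuple B) = 0%E <->
  forall alpha, bfle alpha (nil_tuple A) (nil_tuple B) 0.
Proof.
rewrite /bf_infty; split=> [h alpha|h].
  change (bf Omega alpha (nil_tuple A) (nil_tuple B) <= 0)%E.
  by rewrite -h; apply: ereal_sup_ubound; exists alpha.
apply/le_anti/andP; split; first by apply: ge_ereal_sup => _ [alpha _ <-]; exact: h.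
by apply: le_trans (bf_ge0 wO ozero _ _) _; apply: ereal_sup_ubound; exists ozero.
Qed.

(** A move costs one stage except at a stage stable for the pair. Starting from such a stage, [b] is
    matched entry by entry, half of the error being kept for the last one. *)
Lemma bf_infty0_back A B : separable A -> separable B ->
  bf_infty Omega (nil_tuple A) (nil_tuple B) = 0%E ->
  forall alpha n (b : n.-tuple B) e, 0 < e -> exists a : n.-tuple A, bfle alpha a b e.
Proof.
move=> sA sB /bf_infty0P h alpha n b e e0.
have [lambda st _] := exists_stable wO sA sB.
suff [a ha] : exists a : n.-tuple A, bfle lambda a b e.
  by exists a; exact: stable_forever ha.
rewrite -(prefix_tuple_nth b); move: (nth point b) => {b} v.
elim: n e e0 => [|n IH] e e0.
  exists (nil_tuple A); rewrite (tuple0 (prefix_tuple 0 v)) (tuple0 [tuple]).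
  by apply: bfle_le (h lambda); exact: ltW.
have e20 : 0 < e / 2 by rewrite divr_gt0.
have [a /st/bfle_succ[_ hB]] := IH _ e20; have [c hc] := hB (v n) _ e20.
exists (rcons_tuple a c).
have -> : prefix_tuple n.+1 v = rcons_tuple (prefix_tuple n v) (v n).
  rewrite rcons_prefix_tuple; congr prefix_tuple; apply/funext => i /=.
  by case: eqVneq => [->|].
by rewrite (splitr e).
Qed.

(** Choose [a'] in [A] close to [b] at stage [alpha + 1], hence also at stage [alpha]. At both
    stages [b] may be replaced by [a'] up to the error, and on [a], [a'] the two stages agree. *)
Lemma scott_rank_transfer A B alpha : separable A -> separable B ->
  bf_stable Omega A alpha ->
  bf_infty Omega (nil_tuple A) (nil_tuple B) = 0%E ->
  forall n (a : n.-tuple A) (b : n.-tuple B), tdist (osucc alpha) a b <= tdist alpha a b.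
Proof.
move=> sA sB st h n a b; apply/ler_addgt0Pr => e e0.
have e20 : 0 < e / 2 by rewrite divr_gt0.
have [a' h1] := bf_infty0_back sA sB h (osucc alpha) b e20.
have {}h1 : tdist (osucc alpha) a' b <= e / 2 by apply/tdist_leP => //; right.
have h0 : tdist alpha a' b <= e / 2.
  by apply: le_trans h1; apply: tdist_mono => //; exact: oltW (olt_succ _).
have eqa : tdist (osucc alpha) a a' = tdist alpha a a'.
  by apply: eq_tdist; rewrite st.
have := tdist_triangle wO (osucc alpha) a a' b.
have := tdist_triangle wO alpha a b a'; rewrite (tdist_sym wO alpha b a') eqa; lra.
Qed.

(** Density extends the comparison to all tuples. Then stage [alpha] bounds every stage by
    induction, entirely for truncated distances; a truncated distance at most 0 forces the true one
    to be so. *)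
Lemma scott_rank_criterion A B alpha (C : nat -> A) (D : nat -> B) :
  dense_seq C -> dense_seq D ->
  tdist alpha (nil_tuple A) (nil_tuple B) <= 0 ->
  (forall n (j l : n.-tuple nat), tdist (osucc alpha) (map_tuple C j) (map_tuple D l) <=
     tdist alpha (map_tuple C j) (map_tuple D l)) ->
  bf_infty Omega (nil_tuple A) (nil_tuple B) = 0%E.
Proof.
move=> dC dD h0 h.
have {}h n (a : n.-tuple A) (b : n.-tuple B) : tdist (osucc alpha) a b <= tdist alpha a b.
  (* Two tuples are moved at each of the two stages. *)
  apply/ler_addgt0Pr => e e0; have e40 : 0 < e / 4 by rewrite divr_gt0.
  have [j hj] := dense_approx wO a dC e40; have [l hl] := dense_approx wO b dD e40.
  have sw A' (u v : n.-tuple A') : tuple_dist u v = tuple_dist v u.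
    by apply/funext => i; exact: metric_sym.
  have h1 := tdist_move wO alpha hj hl.
  rewrite sw in hj; rewrite sw in hl.
  have h2 := tdist_move wO (osucc alpha) hj hl.
  have := h n j l; lra.
have {}h beta n (a : n.-tuple A) (b : n.-tuple B) : tdist beta a b <= tdist alpha a b.
  elim/ord_ind3: beta n a b => [beta beta' bb IH||beta IH|beta lb IH] n a b.
  - by rewrite -(tdist_oeq a b bb).
  - by apply: tdist_mono => //; exact: ole_zero.
  - have /(tdist_succP wO)[hA hB] := h n a b; apply/tdist_succP => //; split.
      by move=> c e /(hA c)[d hd]; exists d; exact: le_trans (IH _ _ _) hd.
    by move=> d e /(hB d)[c hc]; exists c; exact: le_trans (IH _ _ _) hc.
  - by apply/tdist_limitP => // gamma gb; exact: IH.
apply/bf_infty0P => beta.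
have /(tdist_leP wO)[|//] := le_trans (h beta 0%N (nil_tuple A) (nil_tuple B)) h0.
by rewrite ler10.
Qed.

End ScottCriterion.

(** * The Scott sentence and its quantifier rank *)

Section ScottSentence.
Context {R : realType} {L : signature R} {Omega : (nat -> R) -> \bar R}.
Hypothesis wO : is_weak_modulus Omega.
Hypothesis cL : countable_signature L.
Implicit Types (A B C : structure L).
Local Notation tdist := (tdist (Omega := Omega)).
Local Notation tm := (trunc_modulus Omega).

(** Binds the variables below [n], the last of them innermost. *)
Fixpoint qsups n (phi : formula L) : formula L :=
  if n is m.+1 then qsups m (QSup m phi) else phi.

Lemma qr_qsups n phi : qr (qsups n phi) = iter n osucc (qr phi).
Proof. by elim: n phi => //= n IH phi; rewrite IH -iterSr. Qed.

Lemma unit_qsups n Delta phi : unit_formula n Delta phi ->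
  unit_formula 0 (fun delta => Delta (fun i => if (i < n)%N then 0 else delta i)) (qsups n phi).
Proof.
elim: n Delta phi => [|n IH] Delta phi //= /unit_QSup/IH.
apply: unit_formula_le => x _; rewrite le_eqVlt; apply/orP; left; apply/eqP.
congr Delta; apply/funext => i /=; rewrite ltnS [(i <= n)%N]leq_eqVlt.
by case: eqVneq.
Qed.

Lemma eval_qsups B n phi (v : nat -> B) :
  (forall w : nat -> B, 0 <= eval w phi <= 1) ->
  0 <= eval v (qsups n phi) <= 1 /\
  (eval v (qsups n phi) <= 0 <->
    forall w, (forall i, (n <= i)%N -> w i = v i) -> eval w phi <= 0).
Proof.
elim: n phi => [|n IH] phi u01 /=.
  split=> //; split=> [h w wv|h]; last exact: h.
  by rewrite (_ : w = v)//; apply/funext => i; exact: wv.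
have f01 (w : nat -> B) (c : B) : 0 <= eval [eta w with n |-> c] phi <= 1 by exact: u01.
have [w|h1 h2] := IH (QSup n phi); first exact: (sup_family01 (point : B) (f01 w)).
split=> //; rewrite h2; split=> [h w wv|h w wv].
  (* The induction hypothesis requires the value [v n] at variable [n]; [w'] has it, and the
     supremum over that variable gives back [w n]. *)
  pose w' : nat -> B := [eta w with n |-> v n].
  have w'v i : (n <= i)%N -> w' i = v i.
    rewrite /w' /= leq_eqVlt eq_sym; case: eqVneq => [->//|_ /=]; exact: wv.
  have := (sup_family_leP (point : B) (f01 w') 0).1 (h w' w'v) (w n).
  congr (eval _ _ <= _); apply/funext => i; rewrite /w' /=.
  by case: eqVneq => [->|].
apply/(sup_family_leP (point : B) (f01 w)) => c; apply: h => i /= ni.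
rewrite gtn_eqF//; apply: wv; exact: ltnW.
Qed.

Lemma iter_osucc_le n a b : ole a b -> ole (iter n osucc a) (iter n osucc b).
Proof. by elim: n => //= n IH ab; apply/ole_succ2/IH. Qed.

(** The rank is exactly [alpha + omega]: the gap between the two stages has rank [alpha + 1] for
    tuples of any length [n], binding its variables adds [n], and [n] is unbounded. *)
Theorem scott_sentence A alpha : separable A -> ocountable alpha ->
  bf_stable Omega A alpha -> exists sigma : formula L,
  [/\ sentence sigma,
      forall B, separable B -> bf_infty Omega (nil_tuple A) (nil_tuple B) = 0%E <->
        interp (nil_tuple B) sigma = 0
    & oeq (qr sigma) (oadd alpha omega)].
Proof.
move=> sA ca st; have [C dC] := separable_dense_seq sA.
have cs := ocountable_succ ca.
have [phi [uphi qphi ephi]] := defines_exists wO cL sA ca (nil_tuple A).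
pose index : countType := {n : nat & n.-tuple nat}.
have /choice[phi0 h0] : forall s : index, exists phi,
    defines (Omega := Omega) alpha (map_tuple C (projT2 s)) phi.
  by move=> s; exact: defines_exists.
have /choice[phi1 h1] : forall s : index, exists phi,
    defines (Omega := Omega) (osucc alpha) (map_tuple C (projT2 s)) phi.
  by move=> s; exact: defines_exists.
pose gap s := Conn tsub (pair_family (phi1 s) (phi0 s)).
pose chi (s : index) := qsups (projT1 s) (gap s).
(* [phi] expresses that stage [alpha] vanishes on the empty tuples; it also fills the positions that
   code no tuple. *)
pose part k := if k is k'.+1 then (if unpickle k' is Some s then chi s else phi) else phi.
have partP (Q : formula L -> Prop) : (forall k, Q (part k)) <-> (Q phi /\ forall s, Q (chi s)).
  split=> [h|[hp hc] [|k] //=]; last by case: unpickle.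
  by split=> [|s]; [exact: (h 0%N)|have := h (pickle s).+1; rewrite /= pickleK].
pose sigma := Vee (tm 0) 0 1 part.
(* The modulus in no variables is zero, and so is the doubled modulus of a gap once its variables
   are bound. *)
have tm0 x : tm 0 x = 0 by exact: trunc_modulus_eq0.
have uchi s : unit_formula 0 (tm 0) (chi s).
  have [u0 _ _] := h0 s; have [u1 _ _] := h1 s.
  have := unit_qsups (unit_tsub (trunc_modulus_ge0 wO _) u1 u0).
  apply: unit_formula_le => x _; rewrite tm0 !trunc_modulus_eq0 ?addr0// => i ->//.
have [upart _] := partP (unit_formula 0 (tm 0)).
have usigma : unit_formula 0 (tm 0) sigma.
  apply: unit_Vee; first exact: trunc_modulusP.
  by apply/partP.
have egap B s (w : nat -> B) : eval w (gap s) = Num.max 0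
   (tdist (osucc alpha) (map_tuple C (projT2 s)) (prefix_tuple (projT1 s) w) -
    tdist alpha (map_tuple C (projT2 s)) (prefix_tuple (projT1 s) w)).
  by have [_ _ <-] := h1 s; have [_ _ <-] := h0 s.
have gap01 B s (w : nat -> B) : 0 <= eval w (gap s) <= 1.
  rewrite egap le_max lexx ge_max ler01 /=.
  have := tdist01 wO (osucc alpha) (map_tuple C (projT2 s)) (prefix_tuple (projT1 s) w).
  have := tdist01 wO alpha (map_tuple C (projT2 s)) (prefix_tuple (projT1 s) w).
  lra.
exists sigma; split.
- split; first by have [] := usigma.
  by rewrite -subset0 => i; have [_ f _ _] := usigma; move=> /f.
- move=> B sB; pose v := nth point (nil_tuple B).
  have part01 : forall k, 0 <= eval v (part k) <= 1.
    apply/(partP (fun c => 0 <= eval v c <= 1)); split; first by rewrite ephi tdist01.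
    by move=> s; have [] := eval_qsups (projT1 s) v (@gap01 B s).
  have -> : interp (nil_tuple B) sigma = 0 <-> interp (nil_tuple B) sigma <= 0.
    split=> [->//|h]; apply/le_anti; rewrite h /=.
    by have /andP[] := sup_family01 0%N part01.
  rewrite (sup_family_leP 0%N part01) (partP (fun c => eval v c <= 0)).
  split=> [h|[hphi hchi]].
    split.
      rewrite ephi; apply/tdist_leP => //; right.
      rewrite (tuple0 (prefix_tuple 0 v)) (tuple0 [tuple]).
      exact: (bf_infty0P wO A B).1 h alpha.
    move=> s; have [_ ->] := eval_qsups (projT1 s) v (@gap01 B s) => w _.
    by rewrite egap ge_max lexx subr_le0; exact: scott_rank_transfer.
  have [D dD] := separable_dense_seq sB.
  apply: (scott_rank_criterion wO dC dD (alpha := alpha)).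
    by move: hphi; rewrite ephi (tuple0 (prefix_tuple 0 v)) (tuple0 [tuple]).
  move=> n j l; pose s : index := existT _ n j.
  have [_ [/(_ (hchi s)) hw _]] := eval_qsups n v (@gap01 B s).
  pose w i := if (i < n)%N then nth point (map_tuple D l) i else v i.
  have {hw} : eval w (gap s) <= 0 by apply: hw => i; rewrite /w leqNgt => /negbTE ->.
  rewrite egap ge_max lexx subr_le0 /= (_ : prefix_tuple n w = map_tuple D l)//.
  by apply: eq_from_tnth => i; rewrite tnth_mktuple (tnth_nth point) /w ltn_ord.
- have qgap s : oeq (qr (gap s)) (osucc alpha).
    have [_ q0 _] := h0 s; have [_ q1 _] := h1 s.
    split; last first.
      by apply: ole_trans q1.2 _; exact: ((bigomaxP _ _).1 (ole_refl (qr (gap s))) ord0).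
    apply/bigomaxP => i; rewrite /pair_family; case: ifP => _; first exact: q1.1.
    exact: ole_trans q0.1 (oltW (olt_succ _)).
  change (oeq (olub (fun k => qr (part k))) (oadd alpha omega)).
  apply: oeq_add_omega => [k|n].
    move: k; apply/(partP (fun c => exists m, ole (qr c) (iter m osucc alpha))); split.
      by exists 0%N; exact: qphi.1.
    move=> s; exists (projT1 s).+1; rewrite /chi qr_qsups iterSr.
    exact: iter_osucc_le (qgap s).1.
  (* Any tuple of length [n] serves here, since the rank depends on the length only. *)
  pose s : index := existT _ n (nseq_tuple n 0%N).
  exists (pickle s).+1; have -> : part (pickle s).+1 = chi s by rewrite /part pickleK.
  rewrite /chi qr_qsups.
  by apply: iter_osucc_le; exact: ole_trans (oltW (olt_succ _)) (qgap s).2.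
Qed.

End ScottSentence.

(** * Borel complexity *)


Section Sigma0Theory.
Context {T : topologicalType}.
Implicit Types (U : set T) (xi eta : Ord).

Lemma Sigma0_ge1 xi U : Sigma0 xi U -> ole oone xi.
Proof. by case=> {xi U} [xi U [_ h] _|xi e F h _ _ _] //; exact: oltW. Qed.

Lemma Sigma0_bigcupE xi U : olt oone xi -> Sigma0 xi U ->
  exists (e : nat -> Ord) (F : nat -> set T),
  [/\ forall n, ole oone (e n), forall n, olt (e n) xi,
      forall n, Sigma0 (e n) (~` F n) & U = \bigcup_n F n].
Proof.
move=> h s; case: s h => {xi U} [xi U [x1 _] _|xi e F _ e1 ex sF] h.
  by have := olt_ole_trans h x1 => /olt_irr.
by exists e, F.
Qed.

(** Level 1 is excluded because an open set of a general space need not be a countable union of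
    closed sets. *)
Lemma Sigma0_le xi eta U : olt oone xi -> ole xi eta -> Sigma0 xi U -> Sigma0 eta U.
Proof.
move=> x1 xe /(Sigma0_bigcupE x1)[e [F [e1 ex sF ->]]].
apply: Sigma0_bigcup sF => // [|n]; [exact: olt_ole_trans x1 xe|exact: olt_ole_trans (ex n) xe].
Qed.

Lemma Sigma0_setC xi eta U : olt xi eta -> Sigma0 xi U -> Sigma0 eta (~` U).
Proof.
move=> xe sU; have -> : ~` U = \bigcup_(n : nat) ~` U.
  by apply/seteqP; split=> x => [h|[_ _]//]; exists 0%N.
apply: (@Sigma0_bigcup _ _ (fun=> xi)) => // [|n|n].
- exact: ole_olt_trans (Sigma0_ge1 sU) xe.
- exact: Sigma0_ge1 sU.
- by rewrite setCK.
Qed.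

Lemma Sigma0_bigcup_nat xi (F : nat -> set T) : olt oone xi ->
  (forall n, Sigma0 xi (F n)) -> Sigma0 xi (\bigcup_n F n).
Proof.
move=> x1 sF; have /choice[e] n := Sigma0_bigcupE x1 (sF n).
move=> /choice[G hG].
pose dec k := odflt (0%N, 0%N) (unpickle k : option (nat * nat)).
have -> : \bigcup_n F n = \bigcup_k G (dec k).1 (dec k).2.
  apply/seteqP; split=> x.
    move=> [n _]; have [_ _ _ ->] := hG n => -[m _ Gx].
    by exists (pickle (n, m)) => //; rewrite /dec pickleK.
  move=> [k _ Gx]; exists (dec k).1 => //; have [_ _ _ ->] := hG (dec k).1.
  by exists (dec k).2.
apply: (@Sigma0_bigcup _ _ (fun k => e (dec k).1 (dec k).2)
  (fun k => G (dec k).1 (dec k).2)) => // k;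
  by have [h1 h2 h3 _] := hG (dec k).1.
Qed.

Lemma Sigma0_borel xi U : Sigma0 xi U -> <<s @open T >> U.
Proof.
elim=> {xi U} [xi U _ oU|xi e F _ _ _ _ IH]; first exact: sub_sigma_algebra.
apply: sigma_algebra_bigcup => n; have := sigma_algebraCD (IH n).
by rewrite setTD setCK.
Qed.

End Sigma0Theory.

(** * Presentations and continuity in the code *)

Section Presentations.
Context {R : realType} {L : signature R}.
Implicit Types (A B : structure L).

(** Distinct presentations may have the same code. They give direct access to the structure, and
    [pML_surj] brings results back to codes. *)
Record presentation := Presentation {
  pstr : structure L ;
  pseq : nat -> pstr ;
  pstr_separable : separable pstr ;
  pseq_tail_dense : tail_dense pseq }.

Definition pcode (e : presentation) : code_space L := Defs.code (@pseq e).

Lemma pcode_ML e : ML L (pcode e).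
Proof.
exists (pstr e); split; first exact: pstr_separable.
by exists (@pseq e) => //; exact: pseq_tail_dense.
Qed.

Definition pML e : ML L := exist _ (pcode e) (mem_set (pcode_ML e)).

Lemma pML_surj (p : ML L) : exists e, pML e = p.
Proof.
have [A [sA [a da pa]]] := set_valP p.
exists (Presentation sA da); apply: val_inj; exact: esym pa.
Qed.

Lemma pseq_dense e : dense_seq (@pseq e).
Proof.
move=> x d d0; have [_ [k _ <-] xk] := dense_mdist x (pseq_tail_dense (p := e) 0%N) d0.
by exists k.
Qed.

(** Continuity in the code, required of all presentations of nearby codes. It entails that [g]
    depends on the code alone, which spares any use of isomorphisms. *)
Definition code_cont (g : presentation -> R) : Prop := forall e0 (eps : R), 0 < eps ->
  \forall p \near pcode e0, forall e, pcode e = p -> `|g e0 - g e| < eps.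

Lemma code_cont_eq g e e' : code_cont g -> pcode e = pcode e' -> g e = g e'.
Proof.
move=> cg ee; apply/eqP; rewrite -subr_eq0 -normr_le0; apply/ler_addgt0Pr => eps eps0.
by rewrite add0r ltW//; have /nbhs_singleton := cg e eps eps0; apply.
Qed.

Lemma code_cont_coord (s : rel_symbol L) (j : 'I_(rarity s) -> nat) :
  code_cont (fun e => @pcode e s j).
Proof.
move=> e0 eps eps0.
have c1 := @ptws_proj_continuous _
  (fun s : rel_symbol L => {ptws ('I_(rarity s) -> nat) -> R}) s (pcode e0).
have c2 := @ptws_proj_continuous ('I_(rarity s) -> nat) (fun=> R) j (@pcode e0 s).
have /cvgrPdist_lt/(_ _ eps0) h := continuous_comp c1 c2.
by apply: filterS h => p /= hp e ep; rewrite ep.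
Qed.

End Presentations.

Section CodeContinuity.
Context {R : realType} {L : signature R}.
Local Notation presentation := (presentation (L := L)).

(** The usual three-term estimate, in local form: a different [h] may be used for each [e0] and
    [eps]. *)
Lemma code_cont_approx (g h : presentation -> R) : code_cont h ->
  forall e0 (eps : R), 0 < eps ->
  (\forall p \near pcode e0, forall e, pcode e = p -> `|g e - h e| < eps / 3) ->
  \forall p \near pcode e0, forall e, pcode e = p -> `|g e0 - g e| < eps.
Proof.
move=> ch e0 eps eps0 gh; have eps30 : 0 < eps / 3 by rewrite divr_gt0.
have h0 := nbhs_singleton gh e0 erefl.
have hh := ch e0 _ eps30; apply: filterS2 gh hh => p gp hp e ep.
have := gp e ep; have := hp e ep; move: h0; rewrite !ltr_norml.
move=> /andP[? ?] /andP[? ?] /andP[? ?]; apply/andP; split; lra.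
Qed.

(** The value of a term is not a real number, so its continuity is expressed through its distances
    to members of the sequence. *)
Definition term_dist (w : nat -> nat) (t : term L) (l : nat) (e : presentation) : R :=
  mdist (teval (fun i => @pseq _ _ e (w i)) t) (@pseq _ _ e l).

Lemma near_args n (tau : 'I_n -> term L) (w : nat -> nat) e0 (d : R) : 0 < d ->
  (forall k l, code_cont (term_dist w (tau k) l)) ->
  exists lk : 'I_n -> nat, \forall p \near pcode e0, forall e, pcode e = p ->
    forall k, term_dist w (tau k) (lk k) e < d.
Proof.
move=> d0 ct.
have /choice[lk hlk] k := pseq_dense (teval (fun i => @pseq _ _ e0 (w i)) (tau k)) d0.
exists lk.
have h k : \forall p \near pcode e0, forall e, pcode e = p -> term_dist w (tau k) (lk k) e < d.
  have dk0 : 0 < d - term_dist w (tau k) (lk k) e0 by rewrite subr_gt0; exact: hlk.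
  apply: filterS (ct k (lk k) e0 _ dk0) => p hp e /hp; rewrite ltr_norml => /andP[? ?]; lra.
have hall := @filter_forall _ _ _ (nbhs (pcode e0)) (nbhs_filter (pcode e0)) h.
by apply: filterS hall => p hp e ep k; exact: hp.
Qed.

(* At a given code, replace the arguments of the symbol by nearby members of the
   sequence; the approximation persists on a neighbourhood, and the modulus turns
   it into a uniform approximation by a coordinate of the code. *)
Lemma code_cont_term (w : nat -> nat) t l : code_cont (term_dist w t l).
Proof.
elim: t l => [i|F tau IH] l.
  have := @code_cont_coord _ _ (RPred (Dist L)) (fun k : 'I_2 => if k == ord0 then w i else l).
  by congr code_cont; apply/funext => e.
move=> e0 eps eps0; have eps30 : 0 < eps / 3 by rewrite divr_gt0.
have [d d0 hd] := modulus_small (fmodP F) eps30.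
have [lk hlk] := near_args e0 d0 (fun k l => IH k l).
(* The chosen arguments followed by [l]: [insub] fails exactly at the last index. *)
pose x (i : 'I_(farity F).+1) : nat := oapp lk l (insub (val i)).
apply: (@code_cont_approx _ (fun e => @pcode _ _ e (Graph F) x) (code_cont_coord _) e0 eps eps0).
apply: filterS hlk => p hp e ep; rewrite /pcode /Defs.code /=.
have -> : (fun i => @pseq _ _ e (x (widen_ord (leqnSn (farity F)) i))) =
    (fun i => @pseq _ _ e (lk i)).
  by apply/funext => i; rewrite /x /= valK.
have -> : x ord_max = l by rewrite /x insubF//= ltnn.
apply: le_lt_trans (mdist_lipschitz _ _ _ _) _; rewrite mdistxx addr0.
apply: le_lt_trans (fint_respects _ _) _; apply: hd => [|k]; first exact: mdist_orthant.
exact: hp.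
Qed.

Lemma code_cont_atom (w : nat -> nat) P (tau : 'I_(parity P) -> term L) :
  code_cont (fun e : presentation => eval (fun i => @pseq _ _ e (w i)) (Atom tau)).
Proof.
move=> e0 eps eps0; have eps30 : 0 < eps / 3 by rewrite divr_gt0.
have [d d0 hd] := modulus_small (pmodP P) eps30.
have [lk hlk] := near_args e0 d0 (fun k l => code_cont_term w (tau k) l).
apply: (@code_cont_approx (fun e => eval (fun i => @pseq _ _ e (w i)) (Atom tau))
  (fun e => @pcode _ _ e (RPred P) lk) (code_cont_coord _) e0 eps eps0).
apply: filterS hlk => p hp e ep; rewrite /pcode /Defs.code /=.
apply: le_lt_trans (pint_respects _ _) _; apply: hd => [|k]; first exact: mdist_orthant.
exact: hp.
Qed.

Context {Omega : (nat -> R) -> \bar R}.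
Lemma code_cont_basic n phi (j : n.-tuple nat) : @basic_formulas R L Omega n phi ->
  code_cont (fun e : presentation => interp (map_tuple (@pseq _ _ e) j) phi).
Proof.
move=> [[m [f [P [tau phiE]]]] wphi fvn _] e0 eps eps0.
have cf : {within box (fun i => Atom (@tau i)), continuous (f : {ptws 'I_m -> R} -> R)}.
  by move: wphi; rewrite phiE => -[].
pose at_ (e : presentation) i := eval (fun k => @pseq _ _ e (nth 0%N j k)) (Atom (@tau i)).
have ie (e : presentation) : interp (map_tuple (@pseq _ _ e) j) phi = f (at_ e).
  rewrite phiE in fvn *; apply: basic_eval_ext => i /fvn /= ni.
  by rewrite (nth_map 0%N) ?size_tuple.
have boxA e : box (fun i => Atom (@tau i)) (at_ e) by exact: box_eval.
have [d d0 hd] := within_ptws_eps cf (boxA e0) eps0.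
have h i : \forall p \near pcode e0, forall e, pcode e = p -> `|at_ e0 i - at_ e i| < d.
  exact: code_cont_atom d0.
have hall := @filter_forall _ _ _ (nbhs (pcode e0)) (nbhs_filter (pcode e0)) h.
apply: filterS hall => p hp e ep; rewrite !ie; apply: hd => // i; exact: hp.
Qed.

Lemma code_cont_dist_to (g : presentation -> R) (r : R) : code_cont g ->
  code_cont (fun e => Num.min 1 `|r - g e|).
Proof.
move=> cg e0 eps eps0; apply: filterS (cg e0 eps eps0) => p hp e /hp.
apply: le_lt_trans; apply: le_trans (ler_dist_min1 _ _) _.
apply: le_trans (ler_dist_dist _ _) _.
by rewrite opprB addrC addrA subrK distrC.
Qed.

End CodeContinuity.

(** * Borel classes of functions of the code *)

Section BorelFunctions.
Context {R : realType} {L : signature R}.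
Local Notation presentation := (presentation (L := L)).
Implicit Types (S : set presentation) (xi eta : Ord).

Definition code_Sigma0 xi S : Prop :=
  exists2 V : set (ML L), Sigma0 xi V & forall e, S e <-> V (pML e).

Lemma code_Sigma0_le xi eta S : olt oone xi -> ole xi eta ->
  code_Sigma0 xi S -> code_Sigma0 eta S.
Proof. by move=> x1 xe [V sV SV]; exists V => //; exact: Sigma0_le sV. Qed.

Lemma code_Sigma0_setC xi eta S : olt xi eta -> code_Sigma0 xi S -> code_Sigma0 eta (~` S).
Proof.
move=> xe [V sV SV]; exists (~` V); first exact: Sigma0_setC sV.
by move=> e; split=> h /SV.
Qed.

Lemma code_Sigma0_set0 xi : olt oone xi -> code_Sigma0 xi set0.
Proof.
move=> x1; exists (~` setT); last by move=> e; split=> // /(_ I).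
by apply: Sigma0_setC x1 _; apply: Sigma0_open; [exact: oeq_refl|exact: openT].
Qed.

Lemma code_Sigma0_bigcup (I : countType) xi (S : I -> set presentation) : olt oone xi ->
  (forall i, code_Sigma0 xi (S i)) -> code_Sigma0 xi (\bigcup_i S i).
Proof.
move=> x1 hS; pose S' k := if unpickle k is Some i then S i else set0.
have hS' k : exists V : set (ML L), Sigma0 xi V /\ forall e, S' k e <-> V (pML e).
  suff [V ? ?] : code_Sigma0 xi (S' k) by exists V.
  by rewrite /S'; case: unpickle => [i|]; [exact: hS|exact: code_Sigma0_set0].
have {hS'} /choice[V hV] := hS'.
exists (\bigcup_k V k); first by apply: Sigma0_bigcup_nat => // k; have [] := hV k.
move=> e; split=> [[i _ Sie]|[k _ Vk]].
  by exists (pickle i) => //; apply/(hV _).2; rewrite /S' pickleK.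
have : S' k e by apply/(hV k).2.
by rewrite /S'; case: unpickle => // i Sie; exists i.
Qed.

Lemma code_Sigma0_bigcup_nat xi (S : nat -> set presentation) : olt oone xi ->
  (forall k, code_Sigma0 xi (S k)) -> code_Sigma0 xi (\bigcup_k S k).
Proof. exact: code_Sigma0_bigcup. Qed.

Lemma code_Sigma0_gt g (q : R) : code_cont g -> code_Sigma0 oone [set e | q < g e].
Proof.
move=> cg; exists [set p : ML L | exists2 e, pML e = p & q < g e].
  apply: Sigma0_open; first exact: oeq_refl.
  rewrite openE => p [e ep qe].
  have ge0 : 0 < g e - q by rewrite subr_gt0.
  have h := cg e _ ge0.
  have /= : nbhs p (set_val @^-1` [set c | forall e', pcode e' = c -> `|g e - g e'| < g e - q]).
    by apply: (@initial_continuous _ _ (set_val : ML L -> code_space L) p); rewrite -ep.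
  apply: filterS => p' hp'; have [e' e'p] := pML_surj p'; exists e' => //.
  have := hp' e'; rewrite -e'p => /(_ erefl); rewrite ltr_norml => /andP[_]; lra.
move=> e; split=> [qe|[e' e'e qe']]; first by exists e.
by rewrite /= (code_cont_eq cg (e' := e')) //; have := congr1 set_val e'e.
Qed.

Lemma code_contN g : code_cont g -> code_cont (fun e : presentation => - g e).
Proof.
move=> cg e0 eps eps0; apply: filterS (cg e0 eps eps0) => p hp e /hp.
by rewrite -opprD normrN.
Qed.

Lemma code_Sigma0_lt g (q : R) : code_cont g -> code_Sigma0 oone [set e | g e < q].
Proof.
move=> /code_contN/(code_Sigma0_gt (- q)); congr code_Sigma0.
by apply/funext => e /=; rewrite ltrN2.
Qed.

(** Both kinds of half-lines are kept at one level, since suprema preserve the class of one and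
    infima that of the other. *)
Definition code_measurable xi (g : presentation -> R) : Prop :=
  forall q : R, code_Sigma0 xi [set e | g e < q] /\ code_Sigma0 xi [set e | q < g e].

Lemma code_measurable_le xi eta g : olt oone xi -> ole xi eta ->
  code_measurable xi g -> code_measurable eta g.
Proof. by move=> x1 xe mg q; have [h1 h2] := mg q; split; exact: code_Sigma0_le xe _. Qed.

Lemma lt_natSinvP (x q : R) : x < q <-> exists k : nat, x <= q - k.+1%:R^-1.
Proof.
split=> [xq|[k]]; last by move/le_lt_trans; apply; rewrite ltrBlDr ltrDl invr_gt0.
have qx0 : 0 < q - x by rewrite subr_gt0.
have [k _ /(_ k (leqnn _)) h] := near_infty_natSinv_lt (PosNum qx0).
have {}h : k.+1%:R^-1 < q - x by exact: h.
by exists k; rewrite lerBrDr -lerBrDl ltW.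
Qed.

(* [Sigma0] does not include the open sets in its higher levels, so strict
   inequalities are rewritten as countable unions of closed conditions. *)
Lemma code_measurable_cont xi g : olt oone xi -> code_cont g -> code_measurable xi g.
Proof.
move=> x1 cg q; split.
  have -> : [set e | g e < q] = \bigcup_k ~` [set e | q - k.+1%:R^-1 < g e].
    apply/seteqP; split=> e /=; first by move=> /lt_natSinvP[k h]; exists k => //=; rewrite ltNge h.
    by move=> [k _ /negP]; rewrite -leNgt => h; apply/lt_natSinvP; exists k.
  by apply: code_Sigma0_bigcup_nat => // k; apply: code_Sigma0_setC x1 _; exact: code_Sigma0_gt.
have -> : [set e | q < g e] = \bigcup_k ~` [set e | g e < q + k.+1%:R^-1].
  apply/seteqP; split=> e /=.
    rewrite -ltrN2 => /lt_natSinvP[k h]; exists k => //=; apply/negP; rewrite -leNgt.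
    by move: h; move: (k.+1%:R^-1) => ?; lra.
  move=> [k _ /negP]; rewrite -leNgt -ltrN2 => h; apply/lt_natSinvP; exists k.
  by move: h; move: (k.+1%:R^-1) => ?; lra.
by apply: code_Sigma0_bigcup_nat => // k; apply: code_Sigma0_setC x1 _; exact: code_Sigma0_lt.
Qed.

Section Families.
Variables (xi : Ord) (g : nat -> presentation -> R).
Hypotheses (x1 : olt oone xi) (g01 : forall k e, 0 <= g k e <= 1)
  (mg : forall k, code_measurable xi (g k)).

Let x1S : olt oone (osucc xi). Proof. exact: olt_ole_trans x1 (oltW (olt_succ _)). Qed.

(** Superlevel sets are unions and stay at level [xi]; sublevel sets need complements of these and
    go up by one. *)
Lemma code_measurable_sup : code_measurable (osucc xi) (fun e => sup (range (g^~ e))).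
Proof.
have gtE q : [set e | q < sup (range (g^~ e))] = \bigcup_k [set e | q < g k e].
  apply/seteqP; split=> e /=.
    move=> h; apply: contrapT => /forall2NP h'; move: h; rewrite ltNge => /negP; apply.
    apply/(sup_family_leP 0%N (g01^~ e)) => k; rewrite leNgt; apply/negP => qk.
    by have [/(_ I)|/(_ qk)] := h' k.
  move=> [k _ /= qk]; apply: lt_le_trans qk _.
  exact: (sup_family_leP 0%N (g01^~ e) _).1 (lexx _) k.
have sgt q : code_Sigma0 xi [set e | q < sup (range (g^~ e))].
  by rewrite gtE; apply: code_Sigma0_bigcup_nat => // k; have [] := mg k q.
move=> q; split; last exact: code_Sigma0_le x1 (oltW (olt_succ _)) (sgt q).
have -> : [set e | sup (range (g^~ e)) < q] =
    \bigcup_k ~` [set e | q - k.+1%:R^-1 < sup (range (g^~ e))].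
  apply/seteqP; split=> e /=; first by move=> /lt_natSinvP[k h]; exists k => //=; rewrite ltNge h.
  by move=> [k _ /negP]; rewrite -leNgt => h; apply/lt_natSinvP; exists k.
by apply: code_Sigma0_bigcup_nat => // k; apply: code_Sigma0_setC (olt_succ _) (sgt _).
Qed.

Lemma code_measurable_inf : code_measurable (osucc xi) (fun e => inf (range (g^~ e))).
Proof.
have ltE q : [set e | inf (range (g^~ e)) < q] = \bigcup_k [set e | g k e < q].
  apply/seteqP; split=> e /=.
    move=> h; have q0 : 0 < (q - inf (range (g^~ e))) / 2 by rewrite divr_gt0// subr_gt0.
    have [k hk] := (inf_family_leP 0%N (g01^~ e) _).1 (lexx _) _ q0.
    exists k => //=; apply: le_lt_trans hk _; lra.
  move=> [k _ /= kq]; apply: le_lt_trans kq; apply/(inf_family_leP 0%N (g01^~ e)) => eps eps0.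
  by exists k; rewrite lerDl ltW.
have slt q : code_Sigma0 xi [set e | inf (range (g^~ e)) < q].
  by rewrite ltE; apply: code_Sigma0_bigcup_nat => // k; have [] := mg k q.
move=> q; split; first exact: code_Sigma0_le x1 (oltW (olt_succ _)) (slt q).
have -> : [set e | q < inf (range (g^~ e))] =
    \bigcup_k ~` [set e | inf (range (g^~ e)) < q + k.+1%:R^-1].
  apply/seteqP; split=> e /=.
    rewrite -ltrN2 => /lt_natSinvP[k h]; exists k => //=; apply/negP; rewrite -leNgt.
    by move: h; move: (k.+1%:R^-1) => ?; lra.
  move=> [k _ /negP]; rewrite -leNgt -ltrN2 => h; apply/lt_natSinvP; exists k.
  by move: h; move: (k.+1%:R^-1) => ?; lra.
by apply: code_Sigma0_bigcup_nat => // k; apply: code_Sigma0_setC (olt_succ _) (slt _).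
Qed.

End Families.
End BorelFunctions.

(** * Borel level of each stage and of the class *)

Section ScottComplexity.
Context {R : realType} {L : signature R} {Omega : (nat -> R) -> \bar R}.
Hypothesis wO : is_weak_modulus Omega.
Hypothesis cL : countable_signature L.
Implicit Types (A B C : structure L).
Local Notation presentation := (presentation (L := L)).
Local Notation tdist := (tdist (Omega := Omega)).

Definition tdist_code A alpha n (a : n.-tuple A) (l : n.-tuple nat) (e : presentation) : R :=
  tdist alpha a (map_tuple (@pseq _ _ e) l).

(** The level is fixed before [A], which yields the uniform Borel bound. All stages up to [alpha]
    are included because a Scott rank is only known to be at most a given ordinal. *)
Definition tdist_level alpha beta : Prop := forall gamma, ole gamma alpha ->
  forall A, separable A -> forall n (a : n.-tuple A) l,
  code_measurable beta (tdist_code gamma a l).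

Lemma olt_osucc2 xi : olt oone xi -> olt oone (osucc xi).
Proof. by move=> h; exact: olt_ole_trans h (oltW (olt_succ _)). Qed.

Lemma ole_osucc xi : ole xi (osucc xi).
Proof. exact: oltW (olt_succ _). Qed.

(** Continuous functions are placed at level 2, and the supremum adds one. *)
Lemma tdist_code_zero A n (a : n.-tuple A) l :
  code_measurable (osucc (osucc oone)) (tdist_code ozero a l).
Proof.
have [phi [bphi phiE]] := countable_basics wO cL n.
pose g k (e : presentation) :=
  Num.min 1 `|interp a (phi k) - interp (map_tuple (@pseq _ _ e) l) (phi k)|.
have -> : tdist_code ozero a l = fun e => sup (range (g^~ e)).
  by apply/funext => e; rewrite /tdist_code phiE.
apply: code_measurable_sup => [|k e|k]; first exact: olt_succ.
  by rewrite le_min ler01 normr_ge0 ge_min lexx.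
apply: code_measurable_cont; first exact: olt_succ.
exact: code_cont_dist_to (code_cont_basic l (bphi k)).
Qed.

(** The infimum, the supremum and the maximum, the last taken as the supremum of the sequence [h],
    raise the level by one each. *)
Lemma tdist_code_succ A alpha xi n (a : n.-tuple A) l : olt oone xi -> separable A ->
  (forall (a' : n.+1.-tuple A) l', code_measurable xi (tdist_code alpha a' l')) ->
  code_measurable (osucc (osucc (osucc xi))) (tdist_code (osucc alpha) a l).
Proof.
move=> x1 /separable_dense_seq[C dC] m.
pose t k i := tdist_code alpha (rcons_tuple a (C k)) (rcons_tuple l i).
have t01 k i e : 0 <= t k i e <= 1 by exact: tdist01.
pose g1 k e := inf (range (fun i => t k i e)).
pose g2 i e := inf (range (fun k => t k i e)).
pose h (j : nat) (e : presentation) :=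
  if j is 0 then sup (range (fun k => g1 k e)) else sup (range (fun k => g2 k e)).
have g101 k e : 0 <= g1 k e <= 1 by exact: (inf_family01 0%N (fun i => t01 k i e)).
have g201 i e : 0 <= g2 i e <= 1 by exact: (inf_family01 0%N (fun k => t01 k i e)).
have -> : tdist_code (osucc alpha) a l = fun e => sup (range (h^~ e)).
  apply/funext => e; rewrite /h sup_or.
  rewrite /tdist_code (tdist_succE wO _ _ _ dC (pseq_dense (e := e))).
  congr (Num.max _ _); apply: eq_sup_range => k; apply: eq_inf_range => i;
    by rewrite /t /tdist_code map_rcons_tuple.
have x1' := olt_osucc2 x1.
apply: code_measurable_sup => [|j e|j]; first exact: olt_osucc2.
  by case: j => [|j]; apply: (sup_family01 0%N).
case: j => [|j]; apply: (code_measurable_sup (xi := osucc xi)) => // k.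
  by apply: (code_measurable_inf (xi := xi)) => // i; exact: m.
by apply: (code_measurable_inf (xi := xi) (g := fun i => t i k)) => // i; exact: m.
Qed.

Lemma tdist_level_exists alpha : ocountable alpha ->
  exists beta, [/\ ocountable beta, olt oone beta & tdist_level alpha beta].
Proof.
elim/(well_founded_induction olt_wf): alpha => alpha IH ca.
have [a0|[[alpha' aS]|la]] := ord_cases alpha.
- exists (osucc (osucc oone)); split.
  + by do 3![apply: ocountable_succ]; exact: ocountable_zero.
  + exact: olt_osucc2 (olt_succ _).
  + move=> gamma ga A sA n a l.
    have -> : tdist_code gamma a l = tdist_code ozero a l.
      apply/funext => e; apply: tdist_oeq; split; last exact: ole_zero.
      exact: ole_trans ga a0.1.
    exact: tdist_code_zero.
- have a'a := olt_oeq_succ aS.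
  have [|beta [cb b1 lb]] := IH _ a'a; first exact: ocountable_ole (oltW a'a) ca.
  have b3 : ole beta (osucc (osucc (osucc beta))).
    apply: ole_trans (ole_osucc _) _; apply: ole_trans (ole_osucc _) _; exact: ole_osucc.
  exists (osucc (osucc (osucc beta))); split.
  + by do 3![apply: ocountable_succ].
  + exact: olt_ole_trans b1 b3.
  + move=> gamma ga A sA n a l; have [ga'|ga'] := ole_or_olt gamma alpha'.
      exact: code_measurable_le b1 b3 (lb _ ga' A sA n a l).
    have -> : tdist_code gamma a l = tdist_code (osucc alpha') a l.
      apply/funext => e; apply: tdist_oeq; split; last exact/ole_succ.
      exact: ole_trans ga aS.1.
    by apply: tdist_code_succ => // a' l'; exact: lb (ole_refl _) _ sA _ _ _.
- have [f [fa cof]] := countable_limit la ca.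
  have /choice[b hb] k : exists beta, [/\ ocountable beta, olt oone beta & tdist_level (f k) beta].
    by apply: IH (fa k) _; exact: ocountable_ole (oltW (fa k)) ca.
  have bk k : ole (b k) (osup b) by exact: oltW (olt_osup b k).
  have b1 k : olt oone (b k) by have [] := hb k.
  have cb : ocountable (osup b) by apply: ocountable_osup => k; have [] := hb k.
  have b1' : olt oone (osup b) by exact: olt_ole_trans (b1 0%N) (bk 0%N).
  (* [osup b] lies above the levels of all earlier stages, and the supremum over these stages costs
     one more. *)
  exists (osucc (osup b)); split; [exact: ocountable_succ|exact: olt_osucc2|].
  move=> gamma ga A sA n a l.
  have mk k : code_measurable (osup b) (tdist_code (f k) a l).
    apply: code_measurable_le (b1 k) (bk k) _.
    by have [_ _ lk] := hb k; exact: lk (ole_refl _) _ sA _ _ _.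
  have [ag|gl] := ole_or_olt alpha gamma.
    have -> : tdist_code gamma a l = fun e => sup (range (fun k => tdist_code (f k) a l e)).
      apply/funext => e; rewrite /tdist_code (@tdist_oeq _ _ _ _ _ gamma alpha)//.
      by apply: tdist_limitE => // beta /cof[k [_ ?]]; exists k.
    by apply: code_measurable_sup => // k e; exact: tdist01.
  have [k fk] := cof _ gl.
  have -> : tdist_code gamma a l = tdist_code (f k) a l.
    by apply/funext => e; apply: tdist_oeq; exact: oeq_sym.
  exact: code_measurable_le b1' (ole_osucc _) (mk k).
Qed.

(** Three complements account for the three successors: two write an intersection through a union,
    and the last one passes from the failure of the criterion to the criterion. *)
Lemma Einfty_class_Sigma0 A gamma xi : olt oone xi -> separable A ->
  bf_stable Omega A gamma -> tdist_level (osucc gamma) xi ->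
  Sigma0 (osucc (osucc (osucc xi))) (Einfty_class Omega A).
Proof.
move=> x1 sA st lev; have [C dC] := separable_dense_seq sA.
pose zero e := tdist_code gamma (nil_tuple A) (nil_tuple nat) e.
(* The rational separates the two stages, so that their strict comparison becomes a countable union
   of conditions on one function each. *)
pose index : countType := ({n : nat & n.-tuple nat * n.-tuple nat} * rat)%type.
pose t alpha (s : index) :=
  let: existT n (j, l) := s.1 in tdist_code alpha (map_tuple C j) l.
pose up s := [set e | ratr s.2 < t (osucc gamma) s e].
pose low s := [set e | t gamma s e < ratr s.2].
pose S : set presentation := ~` ([set e | 0 < zero e] `|` \bigcup_s (up s `&` low s)).
have x1' := olt_osucc2 x1; have x1'' := olt_osucc2 x1'.
have m alpha : ole alpha (osucc gamma) -> forall s, code_measurable xi (t alpha s).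
  by move=> ag [[n [j l]] q]; exact: lev.
have gS := ole_osucc gamma.
have : code_Sigma0 (osucc (osucc (osucc xi))) S.
  apply: code_Sigma0_setC (olt_succ _) _.
  have -> : [set e | 0 < zero e] `|` \bigcup_s (up s `&` low s) =
      \bigcup_(o : option index) (if o is Some s then up s `&` low s else [set e | 0 < zero e]).
    apply/seteqP; split=> e.
      by move=> [h|[s _ h]]; [exists None|exists (Some s)].
    by move=> [[s|] _ h]; [right; exists s|left].
  apply: code_Sigma0_bigcup => // -[s|].
    rewrite -[_ `&` _]setCK setCI; apply: code_Sigma0_setC (olt_succ _) _.
    have -> : ~` up s `|` ~` low s = \bigcup_(k : bool) (if k then ~` up s else ~` low s).
      apply/seteqP; split=> e; first by move=> [h|h]; [exists true|exists false].
      by move=> [[] _ h]; [left|right].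
    apply: code_Sigma0_bigcup => // -[]; apply: code_Sigma0_setC (olt_succ _) _.
      by have [] := m (osucc gamma) (ole_refl _) s (ratr s.2).
    by have [] := m gamma gS s (ratr s.2).
  apply: (@code_Sigma0_le _ _ xi) => //.
    by apply: ole_trans (ole_osucc _) _; exact: ole_osucc.
  by have [] := lev gamma gS A sA 0%N (nil_tuple A) (nil_tuple nat) 0.
move=> [V sV SV].
suff -> : Einfty_class Omega A = V by [].
have SE e : S e <-> bf_infty Omega (nil_tuple A) (nil_tuple (pstr e)) = 0%E.
  have dD := pseq_dense (e := e).
  split=> [/not_orP[h0 h]|h].
    apply: (scott_rank_criterion wO dC dD (alpha := gamma)).
      rewrite leNgt; apply/negP => h1; apply: h0.
      by rewrite /= /zero /tdist_code (tuple0 (map_tuple _ _)) (tuple0 [tuple]) in h1 *.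
    move=> n j l; rewrite leNgt; apply/negP => /(@rat_in_itvoo R)[q].
    rewrite in_itv /= => /andP[q1 q2]; apply: h.
    by exists (existT _ n (j, l), q).
  apply/not_orP; split.
    rewrite /= /zero /tdist_code => h0; have := (bf_infty0P wO _ _).1 h gamma.
    move=> hb; have : tdist gamma (nil_tuple A) (nil_tuple (pstr e)) <= 0.
      by apply/tdist_leP => //; right.
    rewrite leNgt => /negP; apply; move: h0.
    by rewrite (tuple0 (map_tuple _ _)) (tuple0 [tuple]).
  move=> [[[n [j l]] q] _ [h1 h2]].
  have := scott_rank_transfer wO sA (pstr_separable e) st h
    (map_tuple C j) (map_tuple (@pseq _ _ e) l).
  by rewrite leNgt => /negP; apply; exact: lt_trans h2 h1.
apply/seteqP; split=> p.
  move=> [B [sB [b db pb]] h]; pose e := Presentation sB db.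
  have ep : pML e = p by apply: val_inj; exact: esym pb.
  by rewrite -ep; apply/SV/SE.
have [e <-] := pML_surj p; move=> /SV/SE h; exists (pstr e) => //.
split; first exact: pstr_separable.
by exists (@pseq _ _ e) => //; exact: pseq_tail_dense.
Qed.

End ScottComplexity.

Theorem theorem1p2 (R : realType) (L : signature R)
    (Omega : (nat -> R) -> \bar R)
    (countableL : countable_signature L)
    (weakOmega : is_weak_modulus Omega) :
  (forall A : structure L, separable A ->
    (exists sigma : formula L,
      [/\ sentence sigma,
          forall B : structure L, separable B ->
            bf_infty Omega (nil_tuple A) (nil_tuple B) = 0%E <->
            interp (nil_tuple B) sigma = 0%R
        & exists2 alpha : Ord, is_scott_rank Omega A alpha &
            oeq (qr sigma) (oadd alpha omega)]) /\
    <<s @open (ML L) >> (Einfty_class Omega A)) /\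
  (forall alpha : Ord, ocountable alpha ->
    exists2 beta : Ord, ocountable beta &
      forall A : structure L, separable A ->
        forall gamma : Ord, is_scott_rank Omega A gamma -> ole gamma alpha ->
          Sigma0 beta (Einfty_class Omega A)).
Proof.
split=> [A sA|alpha ca].
  have [alpha ra ca] := scott_rank_exists weakOmega sA.
  split.
    have [sigma [s1 s2 s3]] := scott_sentence weakOmega countableL sA ca ra.1.
    by exists sigma; split=> //; exists alpha.
  (* The criterion also involves the stage after the Scott rank, hence the level for the successor
     of [alpha]. *)
  have [beta [_ b1 lev]] := tdist_level_exists weakOmega countableL (ocountable_succ ca).
  exact: Sigma0_borel (Einfty_class_Sigma0 weakOmega b1 sA ra.1 lev).
have [beta [cb b1 lev]] := tdist_level_exists weakOmega countableL (ocountable_succ ca).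
exists (osucc (osucc (osucc beta))); first by do 3![apply: ocountable_succ].
move=> A sA gamma rg ga; apply: Einfty_class_Sigma0 b1 sA rg.1 _ => //.
move=> delta dg; apply: lev; apply: ole_trans dg _; exact/ole_succ2.
Qed.
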